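(* There is an algorithm that, given an instance $I=(\mathcal{G},s,X,k)$ of \textsc{$k$-fixed TEXP}, decides whether $I$ is a yes-instance and, if it is, returns an optimal solution (an $(s,1,X)$-tour of minimum arrival time), in time $O(2^k k L n^2)$, where $n=|V(\mathcal{G})|$ and $L$ is the lifetime of $\mathcal{G}$.
   Context: A temporal graph $\mathcal{G}=\langle G_1,\dots,G_L\rangle$ with underlying simple undirected graph $G=(V,E)$, $|V|=n$, and lifetime $L$ is a sequence of graphs $G_t=(V,E_t)$ with $E_t\subseteq E$ for $t\in[L]$; a pair $(e,t)$ with $e\in E_t$ is a time edge. A strict temporal walk is a start time $t_0$ together with an alternating sequence $v_1,(e_1,t_1),v_2,\dots,(e_{l-1},t_{l-1}),v_l$ with $e_i=\{v_i,v_{i+1}\}\in E_{t_i}$ and $1\le t_0\le t_1<t_2<\dots<t_{l-1}\le L$; it starts at $v_1$ at time $t_0$ and visits every $v_i$. For $v\in V$, $t\in[L]$, $X\subseteq V$, a $(v,t,X)$-tour is a strict temporal walk starting at $v$ with start time $t$ that visits every vertex of $X$; its arrival time is the timestep after the timestep at the end of which it has for the first time visited all vertices of $X$. An instance of \textsc{$k$-fixed TEXP} is $(\mathcal{G},s,X,k)$ with $s\in V$ and $X\subseteq V$, $|X|=k$; it is a yes-instance iff an $(s,1,X)$-tour exists in $\mathcal{G}$. An optimal solution of a yes-instance is such a tour of minimum arrival time. *)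

(* Defs.v *)
From Stdlib Require Import Arith List Lia.
Import ListNotations.

(* A temporal graph with vertex set V = {0,..,n-1} and lifetime L.
   tg_edge t u v = true  iff  {u,v} is an edge of G_t. *)
Record tgraph := TGraph {
  tg_n : nat;
  tg_L : nat;
  tg_edge : nat -> nat -> nat -> bool
}.

(* Well-formedness: every G_t (1 <= t <= L) is a simple undirected graph on V;
   the underlying graph G is the union of the E_t, so E_t ⊆ E holds. *)
Definition tgraph_wf (G : tgraph) : Prop :=
  (forall t u v, tg_edge G t u v = true ->
     1 <= t <= tg_L G /\ u < tg_n G /\ v < tg_n G /\ u <> v) /\
  (forall t u v, tg_edge G t u v = tg_edge G t v u).

(* A strict temporal walk starting at v1 with start time t0 is encoded by
   v1, t0 and the list of steps [(t1,v2); (t2,v3); ...; (t_{l-1},v_l)],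
   where step (t_i, v_{i+1}) traverses the time edge ({v_i,v_{i+1}}, t_i). *)

Fixpoint valid_steps (G : tgraph) (u lb : nat) (steps : list (nat * nat)) : Prop :=
  match steps with
  | [] => True
  | (t, v) :: r =>
      lb <= t /\ t <= tg_L G /\ tg_edge G t u v = true /\ valid_steps G v (S t) r
  end.

Definition strict_walk (G : tgraph) (v1 t0 : nat) (steps : list (nat * nat)) : Prop :=
  1 <= t0 <= tg_L G /\ v1 < tg_n G /\ valid_steps G v1 t0 steps.

Definition visited (v1 : nat) (steps : list (nat * nat)) : list nat :=
  v1 :: map snd steps.

Definition tour (G : tgraph) (v t : nat) (X : list nat) (steps : list (nat * nat)) : Prop :=
  strict_walk G v t steps /\ (forall x, In x X -> In x (visited v steps)).

Definition covers (X seen : list nat) : bool :=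
  forallb (fun x => existsb (Nat.eqb x) seen) X.

(* The walk is at v1 at time t0 and, after traversing ({v_i,v_{i+1}}, t_i),
   at v_{i+1} at time t_i + 1.  The arrival time is the time at which the walk
   is at the vertex with which it has visited all of X for the first time,
   i.e. the timestep after the timestep at the end of which X is covered
   (and t0 if X is already covered by the start vertex). *)
Fixpoint arrival_aux (X seen : list nat) (time : nat) (steps : list (nat * nat))
  : option nat :=
  if covers X seen then Some time
  else match steps with
       | [] => None
       | (t, w) :: r => arrival_aux X (w :: seen) (S t) r
       end.

Definition arrival (X : list nat) (v1 t0 : nat) (steps : list (nat * nat)) : option nat :=
  arrival_aux X [v1] t0 steps.

Record instance := Inst {
  i_G : tgraph;
  i_s : nat;
  i_X : list nat
}.

Definition i_k (I : instance) : nat := length (i_X I).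

Definition instance_wf (I : instance) : Prop :=
  tgraph_wf (i_G I) /\ i_s I < tg_n (i_G I) /\ NoDup (i_X I) /\
  (forall x, In x (i_X I) -> x < tg_n (i_G I)).

Definition yes_instance (I : instance) : Prop :=
  exists steps, tour (i_G I) (i_s I) 1 (i_X I) steps.

Definition optimal_solution (I : instance) (steps : list (nat * nat)) : Prop :=
  tour (i_G I) (i_s I) 1 (i_X I) steps /\
  forall steps', tour (i_G I) (i_s I) 1 (i_X I) steps' ->
    forall a a', arrival (i_X I) (i_s I) 1 steps = Some a ->
                 arrival (i_X I) (i_s I) 1 steps' = Some a' -> a <= a'.

(* Machine model: unit-cost RAM with one memory array of naturals.         *)
(* Word size is enforced by requiring (in the theorem) that every value    *)
(* written stays polynomially bounded in the size parameters.              *)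

Inductive instr :=
| IConst (a c : nat)
| IAdd (a b c : nat)
| ISub (a b c : nat)        (* M[a] := M[b] - M[c] (trunc.)  *)
| IMul (a b c : nat)
| IDiv (a b c : nat)        (* M[a] := M[b] / M[c] (x/0 = 0) *)
| IMod (a b c : nat)
| ILoad (a b : nat)
| IStore (a b : nat)
| IJmpZ (a l : nat)
| IJmpLt (a b l : nat)
| IHalt.

Definition program := list instr.

Record mstate := MState { pc : nat; mem : nat -> nat }.

Definition upd (m : nat -> nat) (a v : nat) : nat -> nat :=
  fun x => if Nat.eqb x a then v else m x.

Definition halted (P : program) (st : mstate) : Prop :=
  match nth_error P (pc st) with
  | None | Some IHalt => True
  | Some _ => False
  end.

Definition step (P : program) (st : mstate) : mstate :=
  let m := mem st in
  let nx := S (pc st) in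
  match nth_error P (pc st) with
  | None | Some IHalt => st
  | Some (IConst a c) => MState nx (upd m a c)
  | Some (IAdd a b c) => MState nx (upd m a (m b + m c))
  | Some (ISub a b c) => MState nx (upd m a (m b - m c))
  | Some (IMul a b c) => MState nx (upd m a (m b * m c))
  | Some (IDiv a b c) => MState nx (upd m a (m b / m c))
  | Some (IMod a b c) => MState nx (upd m a (m b mod m c))
  | Some (ILoad a b) => MState nx (upd m a (m (m b)))
  | Some (IStore a b) => MState nx (upd m (m a) (m b))
  | Some (IJmpZ a l) => MState (if Nat.eqb (m a) 0 then l else nx) m
  | Some (IJmpLt a b l) => MState (if Nat.ltb (m a) (m b) then l else nx) m
  end.

Definition written_value (P : program) (st : mstate) : nat :=
  let m := mem st in
  match nth_error P (pc st) with
  | Some (IConst _ c) => c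
  | Some (IAdd _ b c) => m b + m c
  | Some (ISub _ b c) => m b - m c
  | Some (IMul _ b c) => m b * m c
  | Some (IDiv _ b c) => m b / m c
  | Some (IMod _ b c) => m b mod m c
  | Some (ILoad _ b) => m (m b)
  | Some (IStore _ b) => m b
  | _ => 0
  end.

Fixpoint exec (P : program) (fuel : nat) (st : mstate) : mstate :=
  match fuel with
  | 0 => st
  | S f => exec P f (step P st)
  end.

(* Input encoding: M[0] = n, M[1] = L, M[2] = s, M[3] = k,
   M[4 .. 4+k-1] = the elements of X,
   M[4+k + (t-1)*n*n + u*n + v] = [ {u,v} ∈ E_t ] for 1 <= t <= L, u,v < n,
   all other cells 0.  The program starts at pc = 0. *)
Definition encode (I : instance) : nat -> nat :=
  let G := i_G I in
  let n := tg_n G in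
  let L := tg_L G in
  let k := i_k I in
  fun a =>
    if Nat.eqb a 0 then n
    else if Nat.eqb a 1 then L
    else if Nat.eqb a 2 then i_s I
    else if Nat.eqb a 3 then k
    else if Nat.ltb a (4 + k) then nth (a - 4) (i_X I) 0
    else if Nat.ltb a (4 + k + L * (n * n)) then
      let b := a - (4 + k) in
      let t := S (b / (n * n)) in
      let r := b mod (n * n) in
      if tg_edge G t (r / n) (r mod n) then 1 else 0
    else 0.

Definition init_state (I : instance) : mstate := MState 0 (encode I).

(* Output decoding: M[0] = 1 (yes) or 0 (no); if yes, M[1] = number of steps l
   and the tour (start vertex s, start time 1) has steps
   (M[2+2i], M[3+2i]) for i < l. *)
Definition decode_steps (m : nat -> nat) : list (nat * nat) :=
  map (fun i => (m (2 + 2 * i), m (3 + 2 * i))) (seq 0 (m 1)).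

Definition correct_output (I : instance) (m : nat -> nat) : Prop :=
  (yes_instance I -> m 0 = 1 /\ optimal_solution I (decode_steps m)) /\
  (~ yes_instance I -> m 0 = 0).

(* Main.v *)
Require Import Defs.
From Stdlib Require Import Arith List Lia Bool FunctionalExtensionality.
Import ListNotations.

(** Process the time steps backwards. For a vertex [v], a time [t] and a set [R] of targets still
    to be visited (a bit mask below [2 ^ k]), the least arrival time of a continuation depends only
    on the values at time [t + 1]: wait at [v], or traverse an edge [{v, u}] of [G_t] and drop [u]
    from [R]. There are [(L + 1) n 2^k] states with at most [n + 1] alternatives each, hence
    [O(2^k L n^2)] operations; storing an optimal alternative for each state lets one read off
    an optimal tour in [O(L)] further steps. *)

(** * Dynamic programme on bit masks *)

(** Tables hold the slack [L + 2 - a] instead of the arrival time [a], and it is maximised. Thus 0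
    means infeasible, a missing edge acts by multiplication with 0, and untouched memory is already
    the bottom row of the table. The offset is 2 because the latest possible arrival time is
    [L + 1], which still has to receive a positive value.

    The remaining difficulty lies in the machine. Input and output both occupy the low cells that
    instructions can address directly, so the input has to be moved away before any work is
    possible, and the tour has to be buffered and moved back at the end. Run time and word size
    concern every single step of the run; they are therefore tracked by the same program logic that
    proves functional correctness. Removing a target from a mask must take constant time, which is
    why it is expressed by division, remainder and a tabulated power of two. *)

Fixpoint bit (X : list nat) (x : nat) : nat :=
  match X with
  | [] => 0
  | y :: l => if x =? y then 1 else 2 * bit l x
  end.

(* For [b = 2 ^ i] this clears bit [i] of [R]; since [R / 0 = 0], it is the identity for [b = 0],
   the value of [bit X] outside [X]. *)
Definition rm (R b : nat) : nat := R - ((R / b) mod 2) * b.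

Lemma rm_le R b : rm R b <= R.
Proof. unfold rm; lia. Qed.

Lemma rm_0_l b : rm 0 b = 0.
Proof. unfold rm; lia. Qed.

Lemma rm_0_r R : rm R 0 = R.
Proof. unfold rm; simpl; lia. Qed.

(** What is subtracted is either 0 or a bit present in [R], so nothing is borrowed and the
    subtraction is the bitwise difference [ldiff]. *)
Lemma testbit_rm R i j :
  Nat.testbit (rm R (2 ^ i)) j = Nat.testbit R j && negb (i =? j).
Proof.
  unfold rm. rewrite <- Nat.testbit_spec'.
  destruct (Nat.testbit R i) eqn:E; cbn [Nat.b2n].
  - rewrite Nat.mul_1_l, Nat.sub_nocarry_ldiff.
    + rewrite Nat.ldiff_spec, Nat.pow2_bits_eqb. reflexivity.
    + apply Nat.bits_inj. intro l.
      rewrite Nat.ldiff_spec, Nat.pow2_bits_eqb, Nat.bits_0.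
      destruct (Nat.eqb_spec i l); subst; rewrite ?E; reflexivity.
  - rewrite Nat.mul_0_l, Nat.sub_0_r.
    destruct (Nat.eqb_spec i j); subst; rewrite ?E; cbn; rewrite ?andb_true_r; reflexivity.
Qed.

Lemma bit_not_in X x : ~ In x X -> bit X x = 0.
Proof.
  induction X as [|y l IH]; cbn; intro H; [reflexivity|].
  destruct (Nat.eqb_spec x y); [subst; tauto|].
  rewrite IH by tauto. reflexivity.
Qed.

Lemma bit_nth X i d : NoDup X -> i < length X -> bit X (nth i X d) = 2 ^ i.
Proof.
  revert i. induction X as [|y l IH]; intros i ND Hi; cbn in Hi; [lia|].
  inversion ND; subst. destruct i; cbn [bit nth].
  - now rewrite Nat.eqb_refl.
  - destruct (Nat.eqb_spec (nth i l d) y) as [E|_].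
    + exfalso. apply H1. rewrite <- E. apply nth_In. lia.
    + rewrite IH by (trivial; lia). reflexivity.
Qed.

(** Serves the loop that tabulates [bit]: a target appended at the end gets the next power of two,
    the others keep theirs. *)
Lemma bit_app_single l y x :
  ~ In y l -> bit (l ++ [y]) x = if x =? y then 2 ^ length l else bit l x.
Proof.
  induction l as [|z l IH]; cbn; intro H; [reflexivity|].
  rewrite IH by tauto.
  destruct (Nat.eqb_spec x y), (Nat.eqb_spec x z); subst; try tauto; lia.
Qed.

Lemma bit_lt X x : bit X x < 2 ^ length X.
Proof.
  induction X as [|y l IH]; cbn [bit length Nat.pow]; [lia|].
  destruct (x =? y); lia.
Qed.

Definition edge_bit (G : tgraph) (t u v : nat) : nat :=
  if tg_edge G t u v then 1 else 0.

(** * The recursion and the walk traced from it *)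

Section DP.

Variables (G : tgraph) (X : list nat).

(* The value of waiting at [v] (the summand [1 - R] is [1] exactly when no target remains) or moving
   at time [t] to some [u < m], maximised, with the vertex attaining it; [f] evaluates states
   at time [t + 1]. *)
Fixpoint best (f : nat -> nat -> nat) (t v R m : nat) : nat * nat :=
  match m with
  | 0 => (f v R + (1 - R), v)
  | S u =>
      let p := best f t v R u in
      let c := f u (rm R (bit X u)) * edge_bit G t v u in
      if fst p <? c then (c, u) else p
  end.

(* At vertex [v] at time [L + 2 - r] with the set [R] of targets left, [slack r v R] is
   [L + 2 - a] for the least arrival time [a], and [0] if no continuation visits [R]. *)
Fixpoint slack (r v R : nat) : nat :=
  match r with
  | 0 => 0
  | S r => fst (best (slack r) (S (tg_L G - r)) v R (tg_n G))
  end.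

Definition choice (r v R : nat) : nat :=
  snd (best (slack r) (S (tg_L G - r)) v R (tg_n G)).

Fixpoint extract (r v R : nat) : list (nat * nat) :=
  match r with
  | 0 => []
  | S r =>
      let u := choice r v R in
      if u =? v then extract r v R
      else (S (tg_L G - r), u) :: extract r u (rm R (bit X u))
  end.

Lemma best_spec f t v R m :
  let p := best f t v R m in
  f v R + (1 - R) <= fst p /\
  (forall u, u < m -> f u (rm R (bit X u)) * edge_bit G t v u <= fst p) /\
  (p = (f v R + (1 - R), v) \/
   snd p < m /\ f v R + (1 - R) < fst p /\
   fst p = f (snd p) (rm R (bit X (snd p))) * edge_bit G t v (snd p)).
Proof.
  induction m as [|m IH]; cbn zeta in *.
  - cbn [best fst]. repeat split; [lia|lia|now left].
  - destruct IH as (I1 & I2 & I3). cbn [best].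
    destruct (Nat.ltb_spec (fst (best f t v R m)) (f m (rm R (bit X m)) * edge_bit G t v m)).
    + cbn [fst snd]. split; [lia|]. split.
      * intros u Hu. destruct (Nat.eq_dec u m); [subst; lia|].
        specialize (I2 u ltac:(lia)). lia.
      * right. lia.
    + split; [lia|]. split.
      * intros u Hu. destruct (Nat.eq_dec u m); [subst; lia|]. apply I2. lia.
      * destruct I3 as [I3|I3]; [now left|right; lia].
Qed.

Lemma edge_bit_le t u v : edge_bit G t u v <= 1.
Proof. unfold edge_bit; destruct (tg_edge _ _ _ _); lia. Qed.

(** The summand 1 for waiting beats every move, since no other vertex has a larger value in the next
    layer. This makes the extracted walk stop once all targets are visited. *)
Lemma best_done f t v m :
  (forall u, f u 0 <= f v 0) -> best f t v 0 m = (f v 0 + 1, v).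
Proof.
  intro H. destruct (best_spec f t v 0 m) as (_ & _ & [E|(_ & E1 & E2)]); [exact E|].
  rewrite rm_0_l in E2. exfalso.
  set (u := snd (best f t v 0 m)) in *.
  pose proof (edge_bit_le t v u). specialize (H u). nia.
Qed.

(** Each remaining layer contributes 1, which encodes that the arrival time is the present time
    [L + 2 - r]. *)
Lemma slack_done r v : slack r v 0 = r.
Proof.
  revert v. induction r as [|r IH]; intro v; [reflexivity|].
  cbn [slack]. rewrite best_done; cbn [fst]; [rewrite IH; lia|].
  intro u. now rewrite !IH.
Qed.

Lemma choice_done r v : choice r v 0 = v.
Proof.
  unfold choice. rewrite best_done; [reflexivity|].
  intro u. now rewrite !slack_done.
Qed.

Lemma extract_done r v : extract r v 0 = [].
Proof.
  induction r as [|r IH]; [reflexivity|].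
  cbn [extract]. now rewrite choice_done, Nat.eqb_refl.
Qed.

(** No arrival precedes the present time. The bound also controls the size of the table entries. *)
Lemma slack_le r v R : slack r v R <= r.
Proof.
  revert v R. induction r as [|r IH]; intros v R; [cbn; lia|].
  cbn [slack].
  destruct (best_spec (slack r) (S (tg_L G - r)) v R (tg_n G)) as (_ & _ & [E|(_ & _ & E2)]).
  - rewrite E. cbn [fst]. specialize (IH v R). lia.
  - rewrite E2. set (u := snd _).
    pose proof (edge_bit_le (S (tg_L G - r)) v u).
    specialize (IH u (rm R (bit X u))). nia.
Qed.

Lemma choice_lt r v R : v < tg_n G -> choice r v R < tg_n G.
Proof.
  intro Hv. unfold choice.
  destruct (best_spec (slack r) (S (tg_L G - r)) v R (tg_n G)) as (_ & _ & [E|(E & _)]).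
  - now rewrite E.
  - exact E.
Qed.

Lemma length_extract r v R : length (extract r v R) <= r.
Proof.
  revert v R. induction r as [|r IH]; intros v R; cbn [extract]; [cbn; lia|].
  destruct (_ =? v); cbn [length].
  - specialize (IH v R). lia.
  - match goal with |- context [extract r ?a ?b] => specialize (IH a b) end. lia.
Qed.

(** * Masks against lists of visited vertices; correctness of the recursion *)

Definition unseen (R : nat) (seen : list nat) : Prop :=
  forall i, Nat.testbit R i = (i <? length X) && negb (existsb (Nat.eqb (nth i X 0)) seen).

Lemma unseen_cons R seen w :
  NoDup X -> unseen R seen -> unseen (rm R (bit X w)) (w :: seen).
Proof.
  intros ND H i. cbn [existsb].
  destruct (in_dec Nat.eq_dec w X) as [Hw|Hw].
  - destruct (In_nth _ _ 0 Hw) as (j & Hj & <-).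
    rewrite bit_nth, testbit_rm, H by trivial.
    destruct (Nat.ltb_spec i (length X)); [|reflexivity].
    destruct (Nat.eqb_spec j i) as [->|N].
    + rewrite Nat.eqb_refl. cbn. now rewrite andb_false_r.
    + destruct (Nat.eqb_spec (nth i X 0) (nth j X 0)) as [E|_].
      * apply NoDup_nth in E; trivial; lia.
      * cbn. now rewrite andb_true_r.
  - rewrite bit_not_in, rm_0_r, H by trivial.
    destruct (Nat.ltb_spec i (length X)); [|reflexivity].
    destruct (Nat.eqb_spec (nth i X 0) w) as [E|_]; [|reflexivity].
    exfalso. apply Hw. rewrite <- E. now apply nth_In.
Qed.

Lemma unseen_all : unseen (2 ^ length X - 1) [].
Proof.
  intro i. cbn [existsb negb]. rewrite andb_true_r.
  replace (2 ^ length X - 1) with (Nat.ones (length X))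
    by (rewrite Nat.ones_equiv; lia).
  destruct (Nat.ltb_spec i (length X)).
  - now apply Nat.ones_spec_low.
  - now apply Nat.ones_spec_high.
Qed.

(** [unseen] fixes every bit of [R], including those beyond [length X], so a mask without unseen
    targets is literally 0. *)
Lemma covers_unseen R seen : unseen R seen -> covers X seen = (R =? 0).
Proof.
  intro H. destruct (Nat.eqb_spec R 0) as [->|N].
  - apply forallb_forall. intros x Hx.
    destruct (In_nth _ _ 0 Hx) as (j & Hj & <-).
    specialize (H j). rewrite Nat.bits_0 in H.
    destruct (Nat.ltb_spec j (length X)); [|lia].
    destruct (existsb _ _); [reflexivity|discriminate].
  - apply not_true_is_false. intro C. apply N, Nat.bits_inj. intro i.
    rewrite H, Nat.bits_0.
    destruct (Nat.ltb_spec i (length X)) as [Hi|]; [|reflexivity].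
    unfold covers in C. rewrite forallb_forall in C.
    now rewrite (C _ (nth_In _ 0 Hi)).
Qed.

(** The clock is returned only if the targets are already covered. This justifies waiting, which
    changes the clock but not the walk. *)
Lemma arrival_aux_uncovered seen t t' steps :
  covers X seen = false ->
  arrival_aux X seen t steps = arrival_aux X seen t' steps.
Proof. intro C. destruct steps as [|[? ?] ?]; cbn; now rewrite C. Qed.

(** Passes between the set-based notion of a tour and the scan performed by [arrival_aux]. *)
Lemma arrival_aux_visits seen t steps :
  (exists a, arrival_aux X seen t steps = Some a) <->
  (forall x, In x X -> In x (seen ++ map snd steps)).
Proof.
  assert (Hc : forall l, covers X l = true <-> (forall x, In x X -> In x l)).
  { intro l. unfold covers. rewrite forallb_forall.
    split; intros H x Hx; specialize (H x Hx).
    - apply existsb_exists in H. destruct H as (y & Hy & E).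
      apply Nat.eqb_eq in E. now subst.
    - apply existsb_exists. exists x. now rewrite Nat.eqb_refl. }
  revert seen t. induction steps as [|[t1 w] l IH]; intros seen t; cbn [arrival_aux map].
  - rewrite app_nil_r, <- Hc. destruct (covers X seen); split; intro H; try easy.
    + eauto.
    + now destruct H.
  - destruct (covers X seen) eqn:C.
    + rewrite Hc in C. split; [|eauto].
      intros _ x Hx. apply in_or_app. auto.
    + rewrite IH. cbn [snd].
      split; intros H x Hx; specialize (H x Hx); cbn in *; rewrite in_app_iff in *; cbn in *; tauto.
Qed.

(** Steps happen no later than time [L]. It follows that a yes-instance has positive slack. *)
Lemma arrival_aux_le v lb seen t steps a :
  valid_steps G v lb steps -> t <= S (tg_L G) ->
  arrival_aux X seen t steps = Some a -> a <= S (tg_L G).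
Proof.
  revert v lb seen t. induction steps as [|[t1 w] l IH]; intros v lb seen t V Ht; cbn.
  - destruct (covers X seen); intro E; now inversion E; subst.
  - destruct V as (V1 & V2 & V3 & V4).
    destruct (covers X seen).
    + intro E; now inversion E; subst.
    + intro E. eapply IH in E; eauto. lia.
Qed.

Lemma valid_steps_weaken v lb lb' steps :
  lb' <= lb -> valid_steps G v lb steps -> valid_steps G v lb' steps.
Proof. destruct steps as [|[t w] l]; cbn; intuition lia. Qed.

(** No walk beats the recursion: its first step either takes place at the present time, and is one
    of the moves compared by [best], or comes later, and then the same walk continues after
    waiting. *)
Lemma slack_complete r v R seen steps a :
  NoDup X -> tgraph_wf G -> r <= S (tg_L G) -> unseen R seen ->
  valid_steps G v (2 + tg_L G - r) steps ->
  arrival_aux X seen (2 + tg_L G - r) steps = Some a ->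
  2 + tg_L G - a <= slack r v R.
Proof.
  intros ND WF. revert v R seen steps.
  induction r as [|r IH]; intros v R seen steps Hr U V E.
  (* At time [L + 2] no step is possible any more, so only the empty walk remains, with slack 0. *)
  - destruct steps as [|[t1 w] l]; cbn [arrival_aux] in E; [|cbn in V; lia].
    destruct (covers X seen); [|discriminate]. inversion E. lia.
  - pose proof (covers_unseen _ _ U) as C.
    destruct (Nat.eqb_spec R 0) as [->|N].
    + rewrite slack_done. destruct steps as [|[? ?] ?]; cbn [arrival_aux] in E;
        rewrite C in E; assert (2 + tg_L G - S r = a) by congruence; lia.
    + assert (Et : 2 + tg_L G - r = S (S (tg_L G - r))) by lia.
      assert (Et' : 2 + tg_L G - S r = S (tg_L G - r)) by lia.
      rewrite Et in IH. rewrite Et' in V, E.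
      cbn [slack].
      destruct (best_spec (slack r) (S (tg_L G - r)) v R (tg_n G)) as (B1 & B2 & _).
      destruct steps as [|[t1 w] l]; cbn [arrival_aux] in E; rewrite C in E; [discriminate|].
      destruct V as (V1 & V2 & V3 & V4).
      destruct (Nat.eq_dec t1 (S (tg_L G - r))) as [->|Nt].
      * specialize (IH w (rm R (bit X w)) (w :: seen) l ltac:(lia)
                      (unseen_cons _ _ _ ND U) V4 E).
        destruct (proj1 WF _ _ _ V3) as (_ & _ & Hw & _).
        specialize (B2 w Hw). unfold edge_bit in B2. rewrite V3 in B2. lia.
      * specialize (IH v R seen ((t1, w) :: l) ltac:(lia) U).
        cbn [valid_steps arrival_aux] in IH. rewrite C in IH.
        specialize (IH ltac:(repeat split; trivial; lia) E). lia.
Qed.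

(** A positive value forces the factor [edge_bit] of a chosen move to be 1, so each extracted step
    is a time edge. As the graphs have no loops, such a step leaves [v]; hence the test [u =? v] in
    [extract] really means waiting. *)
Lemma extract_sound r v R seen :
  NoDup X -> tgraph_wf G -> r <= S (tg_L G) -> unseen R seen -> 0 < slack r v R ->
  valid_steps G v (2 + tg_L G - r) (extract r v R) /\
  arrival_aux X seen (2 + tg_L G - r) (extract r v R) = Some (2 + tg_L G - slack r v R).
Proof.
  intros ND WF. revert v R seen.
  induction r as [|r IH]; intros v R seen Hr U Hs; [cbn in Hs; lia|].
  pose proof (covers_unseen _ _ U) as C.
  destruct (Nat.eqb_spec R 0) as [->|N].
  - rewrite extract_done, slack_done. cbn. now rewrite C.
  - assert (Et : 2 + tg_L G - r = S (S (tg_L G - r))) by lia.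
    assert (Et' : 2 + tg_L G - S r = S (tg_L G - r)) by lia.
    rewrite Et in IH. rewrite Et'.
    cbn [slack extract] in *. unfold choice in *.
    destruct (best_spec (slack r) (S (tg_L G - r)) v R (tg_n G)) as (_ & _ & [E|(E1 & _ & E2)]).
    + rewrite E in *. cbn [fst snd] in *. rewrite Nat.eqb_refl.
      replace (slack r v R + (1 - R)) with (slack r v R) in * by lia.
      destruct (IH v R seen ltac:(lia) U Hs) as (I1 & I2).
      split; [eapply valid_steps_weaken; [|exact I1]; lia|].
      rewrite <- I2. now apply arrival_aux_uncovered.
    + set (u := snd (best (slack r) (S (tg_L G - r)) v R (tg_n G))) in *.
      rewrite E2 in *. unfold edge_bit in *.
      destruct (tg_edge G (S (tg_L G - r)) v u) eqn:Ed; [|lia].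
      destruct (proj1 WF _ _ _ Ed) as (Ht & _ & _ & Huv).
      destruct (Nat.eqb_spec u v); [congruence|].
      rewrite Nat.mul_1_r in *.
      destruct (IH u (rm R (bit X u)) (u :: seen) ltac:(lia) (unseen_cons _ _ _ ND U) Hs)
        as (I1 & I2).
      cbn [valid_steps arrival_aux]. rewrite C. repeat split; trivial; lia.
Qed.

End DP.

(** * From the recursion to optimal solutions *)

Lemma extract_correct (I : instance) :
  instance_wf I -> 1 <= tg_L (i_G I) ->
  let G := i_G I in
  let X := i_X I in
  let R := rm (2 ^ i_k I - 1) (bit X (i_s I)) in
  (0 < slack G X (S (tg_L G)) (i_s I) R <-> yes_instance I) /\
  (0 < slack G X (S (tg_L G)) (i_s I) R ->
   optimal_solution I (extract G X (S (tg_L G)) (i_s I) R)).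
Proof.
  intros (WF & Hs & ND & HX) HL G X R.
  (* The start vertex may itself be a target, so its bit is cleared before the first step. *)
  assert (U : unseen X R [i_s I]) by (apply unseen_cons; [trivial|apply unseen_all]).
  assert (Et : 2 + tg_L G - S (tg_L G) = 1) by lia.
  assert (Opt : 0 < slack G X (S (tg_L G)) (i_s I) R ->
                optimal_solution I (extract G X (S (tg_L G)) (i_s I) R)).
  { intro H. destruct (extract_sound G X (S (tg_L G)) _ R [i_s I] ND WF (le_n _) U H)
      as (V & E).
    rewrite Et in V, E. split.
    - split; [now repeat split|]. apply (arrival_aux_visits X [i_s I] 1). eauto.
    - intros steps' ((_ & _ & V') & _) a a' Ea Ea'.
      unfold arrival in Ea, Ea'. fold X in Ea, Ea'. rewrite E in Ea.
      assert (Ea2 : 2 + tg_L G - slack G X (S (tg_L G)) (i_s I) R = a) by congruence.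
      pose proof (slack_complete G X _ (i_s I) R _ steps' a' ND WF (le_n _) U) as SC.
      rewrite Et in SC. specialize (SC V' Ea'). lia. }
  split; [|exact Opt]. split.
  - intro H. eexists. apply (proj1 (Opt H)).
  - intros (steps & (_ & _ & V) & Vis).
    destruct (proj2 (arrival_aux_visits X [i_s I] 1 steps) Vis) as (a & Ea).
    assert (Ha : a <= S (tg_L G))
      by (eapply (arrival_aux_le G X _ _ _ 1); eauto; fold G in HL; lia).
    pose proof (slack_complete G X _ (i_s I) R _ steps a ND WF (le_n _) U) as SC.
    rewrite Et in SC. specialize (SC V Ea). fold G in Ha. lia.
Qed.

(** * Structured RAM programs *)

(** Loops test at the end, so one backward jump suffices and every body runs at least once. *)
Inductive cmd :=
| Blk (l : list instr)
| Seq (c1 c2 : cmd)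
| IfNz (a : nat) (c : cmd)
| DoLt (c : cmd) (a b : nat).

Fixpoint csize (c : cmd) : nat :=
  match c with
  | Blk l => length l
  | Seq c1 c2 => csize c1 + csize c2
  | IfNz _ c => S (csize c)
  | DoLt c _ _ => S (csize c)
  end.

Fixpoint comp (off : nat) (c : cmd) : program :=
  match c with
  | Blk l => l
  | Seq c1 c2 => comp off c1 ++ comp (off + csize c1) c2
  | IfNz a c => IJmpZ a (S off + csize c) :: comp (S off) c
  | DoLt c a b => comp off c ++ [IJmpLt a b off]
  end.

Lemma length_comp c off : length (comp off c) = csize c.
Proof.
  revert off; induction c; intro off; cbn; trivial.
  - now rewrite length_app, IHc1, IHc2.
  - now rewrite IHc.
  - rewrite length_app, IHc. cbn. lia.
Qed.

Definition code_at (P : program) (off : nat) (l : program) : Prop :=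
  forall i x, nth_error l i = Some x -> nth_error P (off + i) = Some x.

Lemma code_at_app P off l1 l2 :
  code_at P off (l1 ++ l2) -> code_at P off l1 /\ code_at P (off + length l1) l2.
Proof.
  intro H. split; intros i x E.
  - apply H. rewrite nth_error_app1; trivial. apply nth_error_Some. congruence.
  - rewrite <- Nat.add_assoc. apply H. rewrite nth_error_app2 by lia.
    rewrite <- E. f_equal. lia.
Qed.

Lemma code_at_cons P off i l :
  code_at P off (i :: l) -> nth_error P off = Some i /\ code_at P (S off) l.
Proof.
  intro H. split.
  - rewrite <- (Nat.add_0_r off). now apply H.
  - intros j x E. replace (S off + j) with (off + S j) by lia. now apply H.
Qed.

(* The memory is split into a register file [rho], held by the cells below [length rho], and
   a heap [h], which is consulted only above. *)
Definition view (rho : list nat) (h : nat -> nat) : nat -> nat :=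
  fun x => if x <? length rho then nth x rho 0 else h x.

Notation rd rho a := (nth a rho 0).

Fixpoint wr (l : list nat) (a v : nat) : list nat :=
  match l, a with
  | [], _ => []
  | _ :: l, 0 => v :: l
  | x :: l, S a => x :: wr l a v
  end.

Lemma length_wr l a v : length (wr l a v) = length l.
Proof. revert a; induction l; intros [|a']; cbn; auto. Qed.

Lemma nth_wr l a v x :
  a < length l -> nth x (wr l a v) 0 = if x =? a then v else nth x l 0.
Proof.
  revert a x; induction l as [|y l IH]; intros [|a] [|x]; cbn; try lia; intro H; trivial.
  now rewrite IH by lia.
Qed.

Lemma view_reg rho h a : a < length rho -> view rho h a = rd rho a.
Proof. unfold view. now destruct (Nat.ltb_spec a (length rho)); try lia. Qed.

Lemma view_heap rho h a : length rho <= a -> view rho h a = h a.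
Proof. unfold view. now destruct (Nat.ltb_spec a (length rho)); try lia. Qed.

Lemma upd_reg rho h a v :
  a < length rho -> upd (view rho h) a v = view (wr rho a v) h.
Proof.
  intro H. apply functional_extensionality. intro x. unfold upd, view.
  rewrite length_wr, nth_wr by trivial.
  destruct (Nat.eqb_spec x a), (Nat.ltb_spec x (length rho)); trivial; lia.
Qed.

Lemma upd_heap rho h a v :
  length rho <= a -> upd (view rho h) a v = view rho (upd h a v).
Proof.
  intro H. apply functional_extensionality. intro x. unfold upd, view.
  destruct (Nat.eqb_spec x a), (Nat.ltb_spec x (length rho)); trivial; lia.
Qed.

Lemma upd_eq (m : nat -> nat) a v : upd m a v a = v.
Proof. unfold upd. now rewrite Nat.eqb_refl. Qed.

Lemma upd_neq (m : nat -> nat) a v x : x <> a -> upd m a v x = m x.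
Proof. unfold upd. now destruct (Nat.eqb_spec x a). Qed.

Definition instr_ok (N : nat) (i : instr) : bool :=
  match i with
  | IConst a _ => a <? N
  | IAdd a b c | ISub a b c | IMul a b c | IDiv a b c | IMod a b c =>
      (a <? N) && (b <? N) && (c <? N)
  | ILoad a b | IStore a b => (a <? N) && (b <? N)
  | _ => false
  end.

Lemma exec_add P a b st : exec P (a + b) st = exec P b (exec P a st).
Proof. revert st; induction a; intro st; cbn; auto. Qed.

Lemma div_le_dividend a b : a / b <= a.
Proof. destruct b; [cbn; lia|]. apply Nat.Div0.div_le_upper_bound. nia. Qed.

(** * A program logic for results, step counts and word size *)

Section Logic.

Variable B : nat.

(** The bound concerns all intermediate writes, which the final state no longer shows; it is
    therefore carried along with the run. *)
Definition reach (P : program) (p : nat) (m : nat -> nat) (T p' : nat) (m' : nat -> nat) : Prop :=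
  exec P T (MState p m) = MState p' m' /\
  forall j, j < T -> written_value P (exec P j (MState p m)) <= B.

Lemma reach_trans P p1 m1 T1 p2 m2 T2 p3 m3 :
  reach P p1 m1 T1 p2 m2 -> reach P p2 m2 T2 p3 m3 -> reach P p1 m1 (T1 + T2) p3 m3.
Proof.
  intros [E1 W1] [E2 W2]. split.
  - now rewrite exec_add, E1.
  - intros j Hj. destruct (Nat.lt_ge_cases j T1); [auto|].
    replace j with (T1 + (j - T1)) by lia.
    rewrite exec_add, E1. apply W2. lia.
Qed.

Lemma reach_step P p m p' m' :
  step P (MState p m) = MState p' m' -> written_value P (MState p m) <= B ->
  reach P p m 1 p' m'.
Proof.
  intros E W. split; [exact E|].
  intros j Hj. now replace j with 0 by lia.
Qed.

Definition bounded (m : nat -> nat) : Prop := forall x, m x <= B.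

(* In a memory bounded by [B], only [IConst], [IAdd] and [IMul] can write a value above [B]. *)
Definition wp1 (i : instr) (rho : list nat) (h : nat -> nat)
    (Q : list nat -> (nat -> nat) -> Prop) : Prop :=
  match i with
  | IConst a c => c <= B /\ Q (wr rho a c) h
  | IAdd a b c => rd rho b + rd rho c <= B /\ Q (wr rho a (rd rho b + rd rho c)) h
  | ISub a b c => Q (wr rho a (rd rho b - rd rho c)) h
  | IMul a b c => rd rho b * rd rho c <= B /\ Q (wr rho a (rd rho b * rd rho c)) h
  | IDiv a b c => Q (wr rho a (rd rho b / rd rho c)) h
  | IMod a b c => Q (wr rho a (rd rho b mod rd rho c)) h
  | ILoad a b => length rho <= rd rho b /\
      forall w, w = h (rd rho b) -> Q (wr rho a w) h
  | IStore a b => length rho <= rd rho a /\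
      forall h', h' = upd h (rd rho a) (rd rho b) -> Q rho h'
  | _ => False
  end.

Fixpoint wp (l : list instr) (rho : list nat) (h : nat -> nat)
    (Q : list nat -> (nat -> nat) -> Prop) : Prop :=
  match l with
  | [] => Q rho h
  | i :: l => wp1 i rho h (fun rho h => wp l rho h Q)
  end.

(* Total correctness: the run leaves the code of [c] through its end within [D] steps. *)
Definition ht (c : cmd) (rho : list nat) (h : nat -> nat) (D : nat)
    (Q : list nat -> (nat -> nat) -> Prop) : Prop :=
  forall P off, code_at P off (comp off c) -> bounded (view rho h) ->
  exists T rho' h', T <= D /\ reach P off (view rho h) T (off + csize c) (view rho' h') /\
    bounded (view rho' h') /\ length rho' = length rho /\ Q rho' h'.

Lemma bounded_upd m a v : bounded m -> v <= B -> bounded (upd m a v).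
Proof. intros H Hv x. unfold upd. destruct (x =? a); auto. Qed.

Lemma wp1_sound i rho h Q P p :
  instr_ok (length rho) i = true -> wp1 i rho h Q ->
  nth_error P p = Some i -> bounded (view rho h) ->
  exists rho' h', reach P p (view rho h) 1 (S p) (view rho' h') /\
    bounded (view rho' h') /\ length rho' = length rho /\ Q rho' h'.
Proof.
  intros OK W E Bd.
  assert (K : forall a v rho' h',
    upd (view rho h) a v = view rho' h' -> v <= B ->
    step P (MState p (view rho h)) = MState (S p) (upd (view rho h) a v) ->
    written_value P (MState p (view rho h)) = v ->
    length rho' = length rho -> Q rho' h' ->
    exists rho' h', reach P p (view rho h) 1 (S p) (view rho' h') /\
      bounded (view rho' h') /\ length rho' = length rho /\ Q rho' h').
  { intros a v rho' h' E1 Hv Es Ew El HQ. exists rho', h'. repeat split; trivial.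
    - change (step P (MState p (view rho h)) = MState (S p) (view rho' h')).
      now rewrite Es, E1.
    - intros j Hj. replace j with 0 by lia. cbn [exec]. lia.
    - rewrite <- E1. now apply bounded_upd. }
  assert (Br : forall x, x < length rho -> rd rho x <= B).
  { intros x Hx. rewrite <- (view_reg _ h) by trivial. apply Bd. }
  destruct i as [a c|a b c|a b c|a b c|a b c|a b c|a b|a b| | |];
    cbn [instr_ok] in OK; try discriminate;
    repeat (apply andb_true_iff in OK; destruct OK as [OK ?]);
    rewrite ?Nat.ltb_lt in *; cbn [wp1] in W;
    repeat match type of W with _ /\ _ => destruct W as [? W] end.
  1-7: eapply K; [apply upd_reg; trivial| |unfold step; cbn [pc mem]; now rewrite E
       |unfold written_value; cbn [pc mem]; now rewrite E|now rewrite length_wr|];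
       rewrite ?view_reg by trivial; trivial.
  - pose proof (Br b). lia.
  - etransitivity; [apply div_le_dividend|auto].
  - etransitivity; [apply Nat.Div0.mod_le|auto].
  - apply W. now rewrite (view_reg _ _ b), view_heap by trivial.
  - eapply K; [apply upd_heap| |unfold step; cbn [pc mem]; now rewrite E
       |unfold written_value; cbn [pc mem]; now rewrite E|trivial|];
       rewrite ?view_reg by trivial; auto.
Qed.

Lemma ht_blk l rho h Q :
  forallb (instr_ok (length rho)) l = true -> wp l rho h Q -> ht (Blk l) rho h (length l) Q.
Proof.
  revert rho h. induction l as [|i l IH]; intros rho h OK W P off C Bd; cbn in *.
  - exists 0, rho, h. rewrite Nat.add_0_r. repeat split; trivial; lia.
  - apply andb_true_iff in OK. destruct OK as [OK1 OK2].
    apply code_at_cons in C. destruct C as [C1 C2].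
    destruct (wp1_sound _ _ _ _ _ _ OK1 W C1 Bd) as (rho1 & h1 & R1 & Bd1 & L1 & W1).
    rewrite <- L1 in OK2.
    destruct (IH _ _ OK2 W1 P (S off) C2 Bd1) as (T & rho2 & h2 & HT & R2 & Bd2 & L2 & W2).
    exists (S T), rho2, h2. rewrite <- Nat.add_succ_comm. split; [lia|].
    split; [apply (reach_trans _ _ _ 1 _ _ T _ _ R1 R2)|].
    split; [trivial|]. split; [congruence|trivial].
Qed.

Lemma ht_seq c1 c2 rho h D1 D2 (Q1 Q : _ -> _ -> Prop) :
  ht c1 rho h D1 Q1 ->
  (forall rho' h', length rho' = length rho -> Q1 rho' h' -> ht c2 rho' h' D2 Q) ->
  ht (Seq c1 c2) rho h (D1 + D2) Q.
Proof.
  intros H H2 P off C Bd. cbn [csize comp] in *. apply code_at_app in C. destruct C as [C1 C2].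
  rewrite length_comp in C2.
  destruct (H P off C1 Bd) as (T1 & rho1 & h1 & HT1 & R1 & Bd1 & L1 & HQ1).
  destruct (H2 _ _ L1 HQ1 P _ C2 Bd1) as (T2 & rho2 & h2 & HT2 & R2 & Bd2 & L2 & HQ).
  exists (T1 + T2), rho2, h2. rewrite Nat.add_assoc.
  split; [lia|]. split; [eapply reach_trans; eassumption|].
  split; [trivial|]. split; [congruence|trivial].
Qed.

(** The assertion between the two commands is itself a statement about the second one, so symbolic
    execution needs no explicit intermediate condition. *)
Lemma ht_seq_cps c1 c2 rho h D1 D2 Q :
  ht c1 rho h D1 (fun rho' h' => ht c2 rho' h' D2 Q) -> ht (Seq c1 c2) rho h (D1 + D2) Q.
Proof. intro H. eapply ht_seq; [exact H|auto]. Qed.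

Lemma ht_ifnz a c rho h D (Q : _ -> _ -> Prop) :
  a < length rho ->
  (rd rho a = 0 -> Q rho h) -> (rd rho a <> 0 -> ht c rho h D Q) ->
  ht (IfNz a c) rho h (S D) Q.
Proof.
  intros Ha H0 H1 P off C Bd. cbn [csize comp] in *. apply code_at_cons in C. destruct C as [C1 C2].
  assert (S1 : step P (MState off (view rho h)) =
               MState (if rd rho a =? 0 then S off + csize c else S off) (view rho h)).
  { unfold step. cbn [pc mem]. now rewrite C1, view_reg. }
  assert (W1 : written_value P (MState off (view rho h)) <= B).
  { unfold written_value. cbn [pc]. rewrite C1. lia. }
  pose proof (reach_step _ _ _ _ _ S1 W1) as R1.
  destruct (Nat.eqb_spec (rd rho a) 0) as [E|E].
  - exists 1, rho, h. rewrite Nat.add_succ_r.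
    repeat (split; [solve [trivial|lia]|]). auto.
  - destruct (H1 E P _ C2 Bd) as (T & rho1 & h1 & HT & R2 & Bd1 & L1 & HQ).
    exists (S T), rho1, h1. rewrite Nat.add_succ_r.
    split; [lia|]. split; [apply (reach_trans _ _ _ 1 _ _ T _ _ R1 R2)|auto].
Qed.

(** The number [N] of rounds is fixed in advance and the body must show that the closing test agrees
    with it. Each round pays one extra step for the jump. *)
Lemma ht_loop c a b rho h N D (Inv : nat -> list nat -> (nat -> nat) -> Prop) :
  a < length rho -> b < length rho -> 0 < N -> Inv 0 rho h ->
  (forall i rho' h', i < N -> length rho' = length rho -> Inv i rho' h' ->
     ht c rho' h' D (fun rho' h' =>
       Inv (S i) rho' h' /\ (rd rho' a <? rd rho' b) = (S i <? N))) ->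
  ht (DoLt c a b) rho h (N * S D) (Inv N).
Proof.
  intros Ha Hb HN I0 HI P off C Bd. cbn [csize comp] in *.
  apply code_at_app in C. destruct C as [C1 C2].
  rewrite length_comp in C2. apply code_at_cons in C2. destruct C2 as [C2 _].
  assert (K : forall d i rho1 h1, N - i = d -> i < N -> length rho1 = length rho ->
    bounded (view rho1 h1) -> Inv i rho1 h1 ->
    exists T rho' h', T <= d * S D /\
      reach P off (view rho1 h1) T (off + S (csize c)) (view rho' h') /\
      bounded (view rho' h') /\ length rho' = length rho /\ Inv N rho' h').
  2:{ destruct (K (N - 0) 0 rho h) as (T & r & h' & HT & K'); trivial.
      exists T, r, h'. rewrite Nat.sub_0_r in HT. auto. }
  induction d as [|d IH]; intros i rho1 h1 Hd Hi L1 Bd1 Ii; [lia|].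
  destruct (HI i _ _ Hi L1 Ii P off C1 Bd1) as (T2 & rho2 & h2 & HT2 & R2 & Bd2 & L2 & I2 & E2).
  rewrite L1 in L2.
  assert (S1 : step P (MState (off + csize c) (view rho2 h2)) =
               MState (if S i <? N then off else S (off + csize c)) (view rho2 h2)).
  { unfold step. cbn [pc mem]. rewrite C2, !view_reg by congruence. now rewrite E2. }
  assert (W1 : written_value P (MState (off + csize c) (view rho2 h2)) <= B).
  { unfold written_value. cbn [pc]. rewrite C2. lia. }
  pose proof (reach_trans _ _ _ _ _ _ _ _ _ R2 (reach_step _ _ _ _ _ S1 W1)) as R3.
  destruct (Nat.ltb_spec (S i) N) as [Hl|Hl].
  - destruct (IH (S i) rho2 h2 ltac:(lia) Hl L2 Bd2 I2) as (T & rho' & h' & HT & R & Bd' & L' & I').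
    exists (T2 + 1 + T), rho', h'. split; [lia|].
    split; [eapply reach_trans; eassumption|].
    split; [trivial|]. split; [congruence|trivial].
  - replace (S i) with N in I2 by lia.
    exists (T2 + 1), rho2, h2. rewrite (Nat.add_succ_r off).
    split; [nia|]. split; [exact R3|auto].
Qed.

Lemma ht_post c rho h D D' (Q Q' : _ -> _ -> Prop) :
  ht c rho h D Q -> D <= D' ->
  (forall rho' h', length rho' = length rho -> Q rho' h' -> Q' rho' h') -> ht c rho h D' Q'.
Proof.
  intros H HD HQ P off C Bd.
  destruct (H P off C Bd) as (T & r & h' & HT & R & Bd' & L & HQ').
  exists T, r, h'. repeat (split; [solve [trivial|lia]|]). auto.
Qed.

End Logic.

(** * The program *)

Definition seqs (l : list cmd) : cmd := fold_right Seq (Blk []) l.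

(* Every directly addressable cell may hold input, so there is no scratch cell to start from.
   Overwriting [L] by [64 (L n^2 + k)] yields an address beyond the input, from which [L]
   can be recovered once [n] and [k] are known; the low cells are then saved there one by one. *)
Definition free_registers : cmd :=
  Blk [IMul 1 1 0; IMul 1 1 0; IAdd 1 1 3;
       IAdd 1 1 1; IAdd 1 1 1; IAdd 1 1 1; IAdd 1 1 1; IAdd 1 1 1; IAdd 1 1 1;
       IStore 1 0; IConst 0 1].

Definition save_code (j m : nat) : list instr :=
  flat_map (fun j => [IAdd 1 1 0; IStore 1 j]) (seq j m).

(* Registers from here on: 0 = 1, 1 = A, 3 = n, 4 = address of the edges of G_1, 5 = s, 6 = k, 7 = 0,
   8 = L, 10 = 2^k, 11 = 2A, 12 = n 2^k, 13 = table size D = (L + 2) n 2^k, 14 = 3A, where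
   A = 64 (L n^2 + k). Heap: input cell [j >= 2] is copied to [A + j - 1], [bit X] is at [2A], the
   table of [slack] at [3A], that of [choice] at [3A + D], the output is buffered at [3A + 2D]. *)
Definition read_sizes : cmd :=
  Blk [IConst 2 26; ISub 1 1 2; ILoad 3 1; IAdd 4 1 0; ILoad 5 4; IAdd 4 4 0; ILoad 6 4;
       IConst 7 64; IDiv 8 1 7; ISub 8 8 6; IDiv 8 8 3; IDiv 8 8 3; IConst 7 0;
       IConst 9 28].

Definition copy_input : cmd :=
  DoLt (Blk [ILoad 4 9; IAdd 2 1 9; ISub 2 2 0; IStore 2 4; IAdd 9 9 0]) 9 1.

Definition fill_bits : cmd :=
  Seq (Blk [IConst 9 0; IConst 10 1; IAdd 11 1 1; IConst 2 3; IAdd 4 1 2])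
      (DoLt (Blk [ILoad 2 4; IAdd 2 2 11; IStore 2 10; IAdd 10 10 10; IAdd 4 4 0; IAdd 9 9 0]) 9 6).

(** One round of [best]. Registers 22 and 23 run along the edge row of [v] and the table of [bit],
    19 along the previous layer of the table; 20 and 21 hold the best value and its vertex. The
    truncated difference in 26 is nonzero exactly if the candidate is strictly better. *)
Definition inner_step : cmd :=
  seqs [Blk [ILoad 2 23; IDiv 25 18 2; IConst 26 2; IMod 25 25 26; IMul 25 25 2; ISub 25 18 25;
             IAdd 25 25 19; ILoad 25 25; ILoad 26 22; IMul 25 25 26; ISub 26 25 20];
        IfNz 26 (Blk [IAdd 20 25 7; IAdd 21 24 7]);
        Blk [IAdd 19 19 10; IAdd 22 22 0; IAdd 23 23 0; IAdd 24 24 0]].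

(** Register 15 is the table index, from which layer (16), vertex (17) and mask (18) are recovered
    by division. The entry [n 2^k] cells earlier has the same vertex and mask, hence is the value of
    waiting. *)
Definition fill_entry : cmd :=
  seqs [Blk [IDiv 16 15 12; IMod 17 15 12; IDiv 17 17 10; IMod 18 15 10;
             IAdd 19 14 15; ISub 19 19 12; ILoad 20 19; ISub 21 0 18; IAdd 20 20 21;
             IAdd 21 17 7;
             ISub 19 16 0; IMul 19 19 12; IAdd 19 19 14;
             IAdd 22 8 0; ISub 22 22 16; IMul 22 22 3; IAdd 22 22 17; IMul 22 22 3; IAdd 22 22 4;
             IAdd 23 11 7; IConst 24 0];
        DoLt inner_step 24 3;
        Blk [IAdd 2 14 15; IStore 2 20; IAdd 2 2 13; IStore 2 21; IAdd 15 15 0]].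

Definition fill_tables : cmd :=
  Seq (Blk [IMul 12 3 10; IAdd 13 8 0; IAdd 13 13 0; IMul 13 13 12; IAdd 14 11 1; IAdd 15 12 7])
      (DoLt fill_entry 15 13).

Definition start_extraction : cmd :=
  Blk [IAdd 17 5 7; IAdd 2 11 5; ILoad 2 2; ISub 18 10 0;
       IDiv 25 18 2; IConst 26 2; IMod 25 25 26; IMul 25 25 2; ISub 18 18 25;
       IAdd 16 8 0; IAdd 19 14 13; IAdd 19 19 13;
       IMul 2 16 3; IAdd 2 2 17; IMul 2 2 10; IAdd 2 2 18; IAdd 2 2 14; ILoad 20 2;
       IAdd 22 19 0; IAdd 22 22 0].

(** The sum of the two truncated differences is the distance of the vertex numbers, zero exactly for
    waiting. Register 22 is the write position in the output buffer. *)
Definition extraction_step : cmd :=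
  seqs [Blk [IMul 2 16 3; IAdd 2 2 17; IMul 2 2 10; IAdd 2 2 18; IAdd 2 2 14; IAdd 2 2 13;
             ILoad 21 2; ISub 25 21 17; ISub 26 17 21; IAdd 25 25 26];
        IfNz 25 (Blk [IAdd 2 8 0; IAdd 2 2 0; ISub 2 2 16; IStore 22 2; IAdd 22 22 0;
                      IStore 22 21; IAdd 22 22 0; IAdd 17 21 7;
                      IAdd 2 11 21; ILoad 2 2;
                      IDiv 25 18 2; IConst 26 2; IMod 25 25 26; IMul 25 25 2; ISub 18 18 25]);
        Blk [ISub 16 16 0]].

Definition extraction : cmd :=
  seqs [start_extraction;
        DoLt extraction_step 7 16;
        Blk [ISub 23 22 19; IConst 26 2; IDiv 23 23 26; ISub 23 23 0; IAdd 2 19 0; IStore 2 23;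
             IConst 0 0]].

(** Cell 0 is the running address and cell 1 holds the decrement 1. Filling downwards makes cell 1
    the last one overwritten. *)
Fixpoint load_code (m : nat) : list instr :=
  match m with
  | 0 => []
  | S m' => ISub 0 0 1 :: ILoad m 0 :: load_code m'
  end.

Definition write_output : cmd :=
  seqs [Blk [IConst 0 1; IConst 9 28; IAdd 10 8 8; IConst 2 31; IAdd 10 10 2];
        DoLt (Blk [IAdd 2 19 9; ILoad 2 2; IStore 9 2; IAdd 9 9 0]) 9 10;
        Blk [IConst 2 28; IAdd 0 19 2; IConst 1 1];
        Blk (load_code 27);
        Blk [IConst 0 1]].

Definition main : cmd :=
  seqs [free_registers; Blk (save_code 2 26); read_sizes; copy_input; fill_bits;
        fill_tables; extraction; IfNz 20 write_output].

Lemma regs28 (rho : list nat) : length rho = 28 ->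
  exists x0 x1 x2 x3 x4 x5 x6 x7 x8 x9 x10 x11 x12 x13 x14 x15 x16 x17 x18 x19 x20 x21 x22 x23
    x24 x25 x26 x27,
  rho = [x0; x1; x2; x3; x4; x5; x6; x7; x8; x9; x10; x11; x12; x13; x14; x15; x16; x17; x18;
         x19; x20; x21; x22; x23; x24; x25; x26; x27].
Proof.
  intro H. do 28 (destruct rho as [|? rho]; [discriminate|]).
  destruct rho; [|discriminate]. do 28 eexists. reflexivity.
Qed.

(** * Word-size bounds by exponent counting, and symbolic execution *)

Lemma pow_bound_add q x y i j :
  2 <= q -> x <= q ^ i -> y <= q ^ j -> x + y <= q ^ S (i + j).
Proof.
  intros Hq Hx Hy. rewrite Nat.pow_succ_r', Nat.pow_add_r.
  assert (0 < q ^ i /\ 0 < q ^ j) by (split; apply Nat.neq_0_lt_0, Nat.pow_nonzero; lia).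
  assert (q ^ i + q ^ j <= 2 * (q ^ i * q ^ j)) by nia.
  assert (2 * (q ^ i * q ^ j) <= q * (q ^ i * q ^ j)) by now apply Nat.mul_le_mono_r.
  lia.
Qed.

Lemma pow_bound_mul q x y i j : x <= q ^ i -> y <= q ^ j -> x * y <= q ^ (i + j).
Proof. intros Hx Hy. rewrite Nat.pow_add_r. now apply Nat.mul_le_mono. Qed.

Lemma pow_bound_sub q x y i : x <= q ^ i -> x - y <= q ^ i.
Proof. lia. Qed.

Lemma pow_bound_div q x y i : x <= q ^ i -> x / y <= q ^ i.
Proof. pose proof (div_le_dividend x y). lia. Qed.

Lemma pow_bound_mod q x y i : x <= q ^ i -> x mod y <= q ^ i.
Proof. pose proof (Nat.Div0.mod_le x y). lia. Qed.

Lemma pow_bound_leaf q x : x <= q -> x <= q ^ 1.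
Proof. now rewrite Nat.pow_1_r. Qed.

Lemma pow_bound_weaken q x i j : 2 <= q -> x <= q ^ i -> i <= j -> x <= q ^ j.
Proof.
  intros Hq Hx Hij. etransitivity; [exact Hx|]. apply Nat.pow_le_mono_r; lia.
Qed.

Ltac pow_bound :=
  first
    [ eassumption
    | lazymatch goal with
      | |- _ + _ <= _ ^ _ => eapply pow_bound_add; [lia|pow_bound|pow_bound]
      | |- _ * _ <= _ ^ _ => eapply pow_bound_mul; [pow_bound|pow_bound]
      | |- _ - _ <= _ ^ _ => eapply pow_bound_sub; pow_bound
      | |- _ / _ <= _ ^ _ => eapply pow_bound_div; pow_bound
      | |- _ mod _ <= _ ^ _ => eapply pow_bound_mod; pow_bound
      end
    | apply pow_bound_leaf; lia ].

(** Unification assembles an exponent from the syntax of the expression, and computation compares it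
    with the allowed one. The exponent 80 of the theorem leaves room for this crude count. *)
Ltac bound := eapply pow_bound_weaken; [lia|pow_bound|apply Nat.leb_le; reflexivity].

(** Loaded values and updated heaps enter as fresh names with an equation, which keeps the symbolic
    registers small. *)
Ltac wp_step :=
  lazymatch goal with
  | |- wp ?b (?i :: ?l) ?rho ?h ?Q =>
      change (wp1 b i rho h (fun rho' h' => wp b l rho' h' Q)); cbn [wp1 wr nth length]
  | |- wp _ [] _ _ _ => cbn [wp nth]
  end;
  lazymatch goal with
  | |- _ <= _ ^ _ /\ _ => split; [bound|]
  | |- 28 <= _ /\ _ =>
      split; [try first [lia|etransitivity; [|apply Nat.le_add_r]; lia]
             |let w := fresh "w" in let H := fresh "Hw" in intros w H]
  | _ => idtac
  end.

Section Run.

Variable I : instance.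

Local Notation G := (i_G I).
Local Notation X := (i_X I).
Local Notation n := (tg_n (i_G I)).
Local Notation L := (tg_L (i_G I)).
Local Notation s := (i_s I).
Local Notation k := (i_k I).
Local Notation enc := (encode I).

Hypothesis wf : instance_wf I.
Hypothesis HL : 1 <= L.
Hypothesis Hk : 1 <= k.

Variables A K W D q : nat.
Hypothesis HA : A = 64 * (L * (n * n) + k).
Hypothesis HK : K = 2 ^ k.
Hypothesis HW : W = n * K.
Hypothesis HD : D = (L + 2) * W.
Hypothesis Hq : q = 2 ^ k * (L + 2) * ((n + 2) * (n + 2)).

Local Notation B := (q ^ 80).

(** * Sizes and the input encoding *)

Lemma s_lt : s < n.
Proof. now destruct wf as (_ & H & _). Qed.

(** The bounds by powers of [q] serve the word size; the lower bounds on [A] and [D] keep the memory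
    regions apart. *)
Lemma sizes :
  54 <= q /\ n <= q /\ L + 2 <= q /\ k <= q /\ K <= q /\ 1 <= n /\ 2 <= K /\
  A <= q ^ 8 /\ W <= q ^ 2 /\ D <= q ^ 5 /\
  64 * (n * n) <= A /\ 64 * L <= A /\ 64 * n <= A /\ 64 * k <= A /\ 128 <= A /\ W <= D /\ n <= W.
Proof.
  pose proof s_lt.
  assert (HK2 : 2 <= K).
  { rewrite HK. destruct k as [|k']; [lia|]. rewrite Nat.pow_succ_r'.
    pose proof (Nat.pow_nonzero 2 k'). lia. }
  rewrite <- HK in Hq.
  assert (Hn : 9 <= (n + 2) * (n + 2) /\ n <= (n + 2) * (n + 2)) by nia.
  assert (HLn : 3 <= K * (L + 2) /\ K <= K * (L + 2) /\ L + 2 <= K * (L + 2)) by nia.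
  assert (6 <= K * (L + 2)) by nia.
  assert (Hq54 : 54 <= q) by (rewrite Hq; nia).
  assert (HnQ : n <= q) by (rewrite Hq; nia).
  assert (HKL : K <= q /\ L + 2 <= q) by (rewrite Hq; nia).
  assert (Hkq : k <= q) by (pose proof (Nat.pow_gt_lin_r 2 k ltac:(lia)); lia).
  assert (HnL : n * n <= L * (n * n) /\ L <= L * (n * n) /\ n <= n * n) by nia.
  assert (HWq : W <= q ^ 2) by (rewrite HW; cbn; nia).
  assert (64 <= q ^ 2) by (cbn; nia).
  assert (HAq : A <= q ^ 8).
  { rewrite HA. bound. }
  assert (HDq : D <= q ^ 5).
  { rewrite HD. bound. }
  repeat (split; [solve [trivial|lia|nia]|]). rewrite HW. clear - HK2. nia.
Qed.

Lemma encode_size j : 4 + k + L * (n * n) <= j -> enc j = 0.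
Proof.
  intro H. unfold encode.
  destruct (Nat.eqb_spec j 0) as [|_]; [lia|]. destruct (Nat.eqb_spec j 1) as [|_]; [lia|].
  destruct (Nat.eqb_spec j 2) as [|_]; [lia|]. destruct (Nat.eqb_spec j 3) as [|_]; [lia|].
  destruct (Nat.ltb_spec j (4 + k)); [lia|].
  destruct (Nat.ltb_spec j (4 + k + L * (n * n))); [lia|]. reflexivity.
Qed.

Lemma encode_X i : i < k -> enc (4 + i) = nth i X 0.
Proof.
  intro H. unfold encode. cbn [Nat.eqb Nat.add].
  destruct (Nat.ltb_spec (S (S (S (S i)))) (S (S (S (S k))))); [|lia].
  f_equal. lia.
Qed.

(** The case [t = L] is included on purpose: the layer at time [L + 1] reads beyond the input, where
    the zeros agree with the absence of edges at that time. *)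
Lemma encode_edge t v u : v < n -> u < n -> t <= L ->
  enc (4 + k + ((t * n + v) * n + u)) = edge_bit G (S t) v u.
Proof.
  intros Hv Hu Ht. destruct (Nat.eq_dec t L) as [->|Nt].
  - rewrite encode_size by nia. unfold edge_bit.
    destruct (tg_edge G (S L) v u) eqn:E; [|reflexivity].
    apply (proj1 (proj1 wf)) in E. lia.
  - unfold encode. set (j := (t * n + v) * n + u).
    assert (Hj : j < L * (n * n)) by (unfold j; nia).
    assert (Ej : j = (n * n) * t + (v * n + u)) by (unfold j; nia).
    assert (v * n + u < n * n) by nia.
    destruct (Nat.eqb_spec (4 + k + j) 0) as [|_]; [lia|].
    destruct (Nat.eqb_spec (4 + k + j) 1) as [|_]; [lia|].
    destruct (Nat.eqb_spec (4 + k + j) 2) as [|_]; [lia|].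
    destruct (Nat.eqb_spec (4 + k + j) 3) as [|_]; [lia|].
    destruct (Nat.ltb_spec (4 + k + j) (4 + k)); [lia|].
    destruct (Nat.ltb_spec (4 + k + j) (4 + k + L * (n * n))); [|lia].
    cbn zeta. replace (4 + k + j - (4 + k)) with j by lia.
    rewrite <- (Nat.div_unique j (n * n) t (v * n + u)) by trivial.
    rewrite <- (Nat.mod_unique j (n * n) t (v * n + u)) by trivial.
    rewrite <- (Nat.div_unique (v * n + u) n v u) by lia.
    rewrite <- (Nat.mod_unique (v * n + u) n v u) by lia.
    reflexivity.
Qed.

Lemma encode_bounded j : enc j <= B.
Proof.
  destruct sizes as (H1 & H2 & H3 & H4 & _). pose proof s_lt.
  assert (enc j <= q).
  { unfold encode.
    destruct (Nat.eqb_spec j 0) as [|_]; [lia|]. destruct (Nat.eqb_spec j 1) as [|_]; [lia|].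
    destruct (Nat.eqb_spec j 2) as [|_]; [lia|]. destruct (Nat.eqb_spec j 3) as [|_]; [lia|].
    destruct (Nat.ltb_spec j (4 + k)).
    - destruct wf as (_ & _ & _ & HX).
      specialize (HX (nth (j - 4) X 0)). rewrite <- H2. apply Nat.lt_le_incl, HX, nth_In.
      change (length X) with k. lia.
    - destruct (Nat.ltb_spec j (4 + k + L * (n * n))); [|lia].
      cbn zeta. destruct (tg_edge _ _ _ _); lia. }
  bound.
Qed.

(** * Freeing registers, moving the input, tabulating [bit] *)

Definition base (rho : list nat) : Prop :=
  rd rho 0 = 1 /\ rd rho 1 = A /\ rd rho 3 = n /\ rd rho 5 = s /\
  rd rho 6 = k /\ rd rho 7 = 0 /\ rd rho 8 = L.

Ltac size_facts :=
  destruct sizes as (Hq54 & Hnq & HLq & Hkq & HKq & Hn1 & HK2 & HAq & HWq & HDq &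
                     HAnn & HAL & HAn & HAk & HA128 & HWD & HnW);
  pose proof s_lt as Hsn.

Lemma free_registers_ht :
  ht B free_registers (map enc (seq 0 28)) enc 11 (fun rho h =>
    rd rho 0 = 1 /\ rd rho 1 = A /\ (forall x, 2 <= x < 28 -> rd rho x = enc x) /\
    h = upd enc A n).
Proof.
  size_facts.
  apply ht_blk; [reflexivity|]. cbn [map seq].
  change (enc 0) with n. change (enc 1) with L. change (enc 3) with k.
  do 3 wp_step. replace (L * n * n + k) with (L * (n * n) + k) by ring.
  set (z := L * (n * n) + k) in *.
  assert (z <= q ^ 8) by lia.
  wp_step. replace (z + z) with (2 * z) by lia.
  wp_step. replace (2 * z + 2 * z) with (4 * z) by lia.
  wp_step. replace (4 * z + 4 * z) with (8 * z) by lia.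
  wp_step. replace (8 * z + 8 * z) with (16 * z) by lia.
  wp_step. replace (16 * z + 16 * z) with (32 * z) by lia.
  wp_step. replace (32 * z + 32 * z) with A by lia.
  do 3 wp_step.
  split; [reflexivity|]. split; [reflexivity|]. split; [|trivial].
  intros x Hx. do 28 (destruct x as [|x]; [try lia; reflexivity|]). lia.
Qed.

Lemma save_code_wp m j a rho h (Q : _ -> _ -> Prop) :
  length rho = 28 -> rd rho 0 = 1 -> rd rho 1 = a -> 28 <= a -> a + m <= B ->
  2 <= j -> j + m <= 28 ->
  (forall rho' h', length rho' = 28 -> rd rho' 0 = 1 -> rd rho' 1 = a + m ->
     (forall i, i < m -> h' (a + 1 + i) = rd rho (j + i)) ->
     (forall x, x <= a \/ a + m < x -> h' x = h x) -> Q rho' h') ->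
  wp B (save_code j m) rho h Q.
Proof.
  revert j a rho h. induction m as [|m IH]; intros j a rho h Hl H0 H1 Ha HB Hj Hjm HQ.
  - cbn. apply HQ; trivial; lia.
  - unfold save_code. cbn [seq flat_map app]. cbn [wp wp1].
    rewrite H0, H1, !length_wr, !nth_wr by lia. cbn [Nat.eqb].
    split; [lia|]. split; [lia|]. intros h' Eh.
    destruct (Nat.eqb_spec j 1); [lia|].
    apply (IH (S j) (a + 1)); rewrite ?length_wr, ?nth_wr by lia; trivial; try lia.
    intros rho2 h2 L2 Z2 R2 F2 G2. apply HQ; trivial; try lia.
    + intros i Hi. destruct i as [|i].
      * rewrite G2, Eh by lia. rewrite Nat.add_0_r, upd_eq. now rewrite Nat.add_0_r.
      * specialize (F2 i ltac:(lia)). rewrite nth_wr in F2 by lia.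
        destruct (Nat.eqb_spec (S j + i) 1); [lia|].
        replace (j + S i) with (S j + i) by lia. rewrite <- F2. f_equal. lia.
    + intros x Hx. rewrite G2, Eh by lia. apply upd_neq. lia.
Qed.

(** All sources lie below [A] and all destinations above, so nothing still to be read is
    overwritten. The zeros further up become the initial contents of the tables. *)
Definition copied (m : nat) (h : nat -> nat) : Prop :=
  (forall x, 28 <= x < A -> h x = enc x) /\
  (forall j, 2 <= j < m -> h (A + j - 1) = enc j) /\
  (forall x, A + m - 1 <= x -> h x = 0).

Ltac open_regs rho Hl :=
  let E := fresh in
  repeat match goal with x : nat |- _ => clear x end;
  destruct (regs28 rho Hl) as
   (x0 & x1 & x2 & x3 & x4 & x5 & x6 & x7 & x8 & x9 & x10 & x11 & x12 & x13 & x14 & x15 & x16 &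
    x17 & x18 & x19 & x20 & x21 & x22 & x23 & x24 & x25 & x26 & x27 & E);
  subst rho; clear Hl; cbn [nth] in *;
  try subst x0; try subst x1; try subst x2; try subst x3; try subst x4; try subst x5;
  try subst x6; try subst x7; try subst x8; try subst x9; try subst x10; try subst x11;
  try subst x12; try subst x13; try subst x14; try subst x15; try subst x16; try subst x17;
  try subst x18; try subst x19; try subst x20; try subst x21; try subst x22; try subst x23;
  try subst x24; try subst x25; try subst x26; try subst x27.

Tactic Notation "loaded" constr(v) :=
  lazymatch goal with
  | Hw : ?w = _ |- wp _ _ _ _ _ =>
      let E := fresh in assert (E : w = v); [rewrite Hw; clear w Hw|clear Hw; subst w]
  end.

Lemma save_ht rho h :
  length rho = 28 ->
  rd rho 0 = 1 -> rd rho 1 = A -> (forall x, 2 <= x < 28 -> rd rho x = enc x) ->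
  h = upd enc A n ->
  ht B (Blk (save_code 2 26)) rho h 52 (fun rho h =>
    rd rho 0 = 1 /\ rd rho 1 = A + 26 /\ h A = n /\ copied 28 h).
Proof.
  intros Hl H0 H1 He Hh. size_facts.
  apply (ht_blk B (save_code 2 26)); [rewrite Hl; reflexivity|].
  apply (save_code_wp _ _ A); trivial; try lia.
  { bound. }
  intros rho' h' Hl' Z1 R1 F1 F2. split; [trivial|]. split; [trivial|]. split; [|split; [|split]].
  - rewrite F2, Hh, upd_eq by lia. reflexivity.
  - intros x Hx. rewrite F2, Hh, upd_neq by lia. reflexivity.
  - intros j Hj. specialize (F1 (j - 2) ltac:(lia)).
    replace (A + j - 1) with (A + 1 + (j - 2)) by lia. rewrite F1.
    replace (2 + (j - 2)) with j by lia. apply He; lia.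
  - intros x Hx. rewrite F2, Hh, upd_neq by lia. apply encode_size. lia.
Qed.

Lemma read_sizes_ht rho h :
  length rho = 28 -> rd rho 1 = A + 26 -> rd rho 0 = 1 -> h A = n -> copied 28 h ->
  ht B read_sizes rho h 14 (fun rho' h' => base rho' /\ rd rho' 9 = 28 /\ h' = h).
Proof.
  intros Hl H1 H0 HhA (C1 & C2 & C3). size_facts.
  open_regs rho Hl.
  apply ht_blk; [reflexivity|].
  do 2 wp_step. replace (A + 26 - 26) with A by lia.
  wp_step. loaded n; [trivial|].
  wp_step. wp_step. loaded s.
  { replace (A + 1) with (A + 2 - 1) by lia. now rewrite C2 by lia. }
  wp_step. wp_step. loaded k.
  { replace (A + 1 + 1) with (A + 3 - 1) by lia. now rewrite C2 by lia. }
  assert (64 <= q ^ 2) by (cbn; nia).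
  wp_step. wp_step. wp_step. wp_step. wp_step.
  replace (A / 64 - k) with (L * n * n) by (rewrite HA, (Nat.mul_comm 64), Nat.div_mul; lia).
  rewrite !Nat.div_mul by lia.
  do 3 wp_step. repeat split.
Qed.

Ltac ltb_eq :=
  match goal with
  | |- (?a <? ?b) = (?c <? ?d) =>
      destruct (Nat.ltb_spec a b), (Nat.ltb_spec c d); trivial; lia
  end.

(** Copying runs up to [A], the bound already held in register 1; the cells past the input are
    zeros. *)
Lemma copy_input_ht rho h :
  length rho = 28 -> base rho -> rd rho 9 = 28 -> copied 28 h ->
  ht B copy_input rho h ((A - 28) * 6) (fun rho' h' => base rho' /\ copied A h').
Proof.
  intros Hl Hb H9 Hc. size_facts.
  eapply ht_post; [|reflexivity|].
  - apply (ht_loop B _ 9 1 _ _ (A - 28) 5 (fun i rho h =>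
      base rho /\ rd rho 9 = 28 + i /\ copied (28 + i) h)).
    + lia.
    + lia.
    + lia.
    + auto.
    + clear h Hb H9 Hc. rename Hl into Hl', rho into rho'.
      intros i rho h Hi Hl ((B0 & B1 & B3 & B5 & B6 & B7 & B8) & H9 & (C1 & C2 & C3)).
      rewrite Hl' in Hl.
      open_regs rho Hl. apply ht_blk; [reflexivity|].
      assert (i <= q ^ 8) by lia.
      wp_step. loaded (enc (28 + i)); [now apply C1; lia|]. do 5 wp_step.
      split; [|ltb_eq].
      split; [repeat split|]. split; [cbn; lia|].
      split; [|split].
      * intros x Hx. rewrite Hw, upd_neq by lia. now apply C1.
      * intros j Hj. rewrite Hw. destruct (Nat.eq_dec j (28 + i)) as [->|Nj].
        -- now rewrite upd_eq.
        -- rewrite upd_neq by lia. apply C2. lia.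
      * intros x Hx. rewrite Hw, upd_neq by lia. apply C3. lia.
  - intros rho' h' _ (H1 & _ & H3). now replace (28 + (A - 28)) with A in H3 by lia.
Qed.

Lemma firstn_succ_nth (l : list nat) i :
  i < length l -> firstn (S i) l = firstn i l ++ [nth i l 0].
Proof.
  revert i. induction l as [|x l IH]; intros [|i] Hi; cbn in Hi; try lia; [reflexivity|].
  change (x :: firstn (S i) l = x :: (firstn i l ++ [nth i l 0])). now rewrite IH by lia.
Qed.

Lemma nth_not_in_firstn (l : list nat) i :
  NoDup l -> i < length l -> ~ In (nth i l 0) (firstn i l).
Proof.
  intros ND Hi. rewrite <- (firstn_skipn (S i) l) in ND at 1.
  apply NoDup_app_remove_r in ND. rewrite firstn_succ_nth in ND by trivial.
  apply NoDup_remove_2 in ND. now rewrite app_nil_r in ND.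
Qed.

Lemma nth_X_lt i : i < k -> nth i X 0 < n.
Proof. intro H. destruct wf as (_ & _ & _ & HX). apply HX, nth_In. exact H. Qed.

(** [A + 3 + k] is the image of the input cell [4 + k], where the edges of [G_1] begin. *)
Definition inputs (h : nat -> nat) : Prop :=
  (forall x, x < n -> h (A + A + x) = bit X x) /\
  (forall t v u, t <= L -> v < n -> u < n ->
     h (A + 3 + k + ((t * n + v) * n + u)) = edge_bit G (S t) v u).

Lemma fill_bits_ht rho h :
  length rho = 28 -> base rho -> copied A h ->
  ht B fill_bits rho h (5 + k * 7) (fun rho' h' =>
    (base rho' /\ rd rho' 4 = A + 3 + k /\ rd rho' 10 = K /\ rd rho' 11 = A + A) /\
    inputs h' /\ (forall x, A + A + A <= x -> h' x = 0)).
Proof.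
  intros Hl Hb (C1 & C2 & C3). size_facts.
  destruct Hb as (B0 & B1 & B3 & B5 & B6 & B7 & B8). open_regs rho Hl.
  apply (ht_seq_cps B _ _ _ _ 5).
  apply (ht_blk B [IConst 9 0; IConst 10 1; IAdd 11 1 1; IConst 2 3; IAdd 4 1 2]);
    [reflexivity|].
  do 6 wp_step.
  eapply ht_post; [|reflexivity|].
  - apply (ht_loop B _ 9 6 _ _ k 6 (fun i rho h' =>
      base rho /\ rd rho 4 = A + 3 + i /\ rd rho 9 = i /\ rd rho 10 = 2 ^ i /\
      rd rho 11 = A + A /\
      (forall x, x < A + A - 1 -> h' x = h x) /\
      (forall x, x < n -> h' (A + A + x) = bit (firstn i X) x) /\
      (forall x, A + A + n <= x -> h' x = 0))).
    + cbn; lia.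
    + cbn; lia.
    + lia.
    + split; [repeat split|]. cbn [nth]. repeat (split; [solve [lia|auto]|]).
      split; [intros x Hx|intros x Hx]; apply C3; lia.
    + intros i rho h1 Hi Hl
        ((B0 & B1 & B3 & B5 & B6 & B7 & B8) & H4 & H9 & H10 & H11 & C4 & C5 & C6).
      cbn [length] in Hl.
      open_regs rho Hl. apply ht_blk; [reflexivity|].
      assert (2 ^ i <= K) by (rewrite HK; apply Nat.pow_le_mono_r; lia).
      pose proof (nth_X_lt i Hi) as HXi.
      wp_step. loaded (nth i X 0).
      { rewrite C4 by lia. rewrite <- encode_X, <- C2 by lia. f_equal. lia. }
      do 6 wp_step. split; [|ltb_eq].
      split; [repeat split|].
      split; [cbn; lia|]. split; [cbn; lia|]. split; [cbn; lia|]. split; [reflexivity|].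
      rewrite Hw. split; [|split].
      * intros x Hx. rewrite upd_neq by lia. now apply C4.
      * intros x Hx. destruct wf as (_ & _ & ND & _).
        rewrite firstn_succ_nth by trivial.
        rewrite bit_app_single by now apply nth_not_in_firstn.
        rewrite length_firstn, Nat.min_l by (unfold i_k in Hi; lia).
        destruct (Nat.eqb_spec x (nth i X 0)) as [->|Nx].
        -- rewrite (Nat.add_comm _ (A + A)). apply upd_eq.
        -- rewrite upd_neq by lia. now apply C5.
      * intros x Hx. rewrite upd_neq by lia. now apply C6.
  - intros rho' h' _ (Hb & H4 & _ & H10 & H11 & C4 & C5 & C6).
    rewrite <- HK in H10. unfold i_k in C5. rewrite firstn_all in C5.
    repeat (split; [solve [auto]|]). split.
    + split; [trivial|]. intros t v u Ht Hv Hu.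
      assert ((t * n + v) * n + u < L * (n * n) + n * n) by (clear - Ht Hv Hu; nia).
      rewrite <- encode_edge, C4, <- C2 by (trivial; lia). f_equal. lia.
    + intros x Hx. apply C6. lia.
Qed.

(** * Filling the tables *)

Definition idx (r v R : nat) : nat := (r * n + v) * K + R.

Lemma idx_decode r v R :
  v < n -> R < K -> idx r v R / W = r /\ (idx r v R mod W) / K = v /\ idx r v R mod K = R.
Proof.
  intros Hv HR. unfold idx.
  assert (E : (r * n + v) * K + R = W * r + (v * K + R)) by (rewrite HW; ring).
  assert (Hlt : v * K + R < W) by (rewrite HW; clear - Hv HR; nia).
  split; [|split].
  - symmetry. eapply Nat.div_unique; [exact Hlt|exact E].
  - rewrite <- (Nat.mod_unique _ W r (v * K + R) Hlt E).
    symmetry. eapply Nat.div_unique; [exact HR|ring].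
  - symmetry. eapply (Nat.mod_unique _ K (r * n + v)); [exact HR|ring].
Qed.

Lemma idx_surj i : i < D -> W <= i ->
  exists r v R, r <= L /\ v < n /\ R < K /\ i = idx (S r) v R.
Proof.
  intros Hi HWi. size_facts.
  exists (i / W - 1), ((i mod W) / K), (i mod K).
  pose proof (Nat.div_mod i W ltac:(lia)) as E1.
  pose proof (Nat.mod_upper_bound i W ltac:(lia)) as E2.
  pose proof (Nat.div_mod (i mod W) K ltac:(lia)) as E3.
  pose proof (Nat.mod_upper_bound (i mod W) K ltac:(lia)) as E4.
  set (a := i / W) in *. set (b := i mod W) in *.
  set (v := b / K) in *. set (R := b mod K) in *. clearbody a R. clearbody v. clearbody b.
  assert (E5 : i mod K = R).
  { symmetry. apply (Nat.mod_unique _ _ (n * a + v)); [trivial|]. rewrite E1, E3, HW. ring. }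
  rewrite E5.
  assert (1 <= a) by (clear - E1 E2 HWi; nia).
  assert (a < L + 2) by (clear - E1 Hi HD; nia).
  assert (v < n) by (clear - E2 E3 HW; nia).
  repeat (split; [solve [trivial|lia]|]).
  unfold idx. replace (S (a - 1)) with a by lia. rewrite E1, E3, HW. ring.
Qed.

(** The layer is the most significant digit of the index, so entries depend only on smaller indices
    and one increasing sweep fills the table. *)
Lemma idx_lt_row r u R r' v R' : u < n -> R < K -> r < r' -> idx r u R < idx r' v R'.
Proof.
  intros Hu HR Hr. unfold idx.
  assert (H1 : (r * n + u) * K + R < (r * n + n) * K) by (clear - Hu HR; nia).
  assert (H2 : (r * n + n) * K <= (r' * n + v) * K)
    by (apply Nat.mul_le_mono_r; clear - Hr; nia).
  lia.
Qed.

Lemma idx_lt_D r v R : r <= S L -> v < n -> R < K -> idx r v R < D.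
Proof.
  intros Hr Hv HR. replace D with (idx (L + 2) 0 0) by (unfold idx; rewrite HD, HW; ring).
  apply idx_lt_row; trivial; lia.
Qed.

Definition dp_regs (rho : list nat) : Prop :=
  base rho /\ rd rho 4 = A + 3 + k /\ rd rho 10 = K /\ rd rho 11 = A + A /\
  rd rho 12 = W /\ rd rho 13 = D /\ rd rho 14 = A + A + A.

(** [choice r] sits at layer [S r] because that decision is taken with [S r] layers left. *)
Definition dp_heap (i : nat) (h : nat -> nat) : Prop :=
  inputs h /\
  (forall r v R, v < n -> R < K -> idx r v R < i ->
     h (A + A + A + idx r v R) = slack G X r v R) /\
  (forall r v R, v < n -> R < K -> idx (S r) v R < i ->
     h (A + A + A + D + idx (S r) v R) = choice G X r v R).

Lemma bit_le_q x : bit X x <= q.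
Proof.
  pose proof (bit_lt X x) as H. size_facts. change (length X) with k in H.
  rewrite <- HK in H. lia.
Qed.

Definition inner_inv (r v R i : nat) (h : nat -> nat) (u : nat) (rho : list nat) (h' : nat -> nat)
  : Prop :=
  h' = h /\ dp_regs rho /\ rd rho 15 = i /\ rd rho 18 = R /\
  rd rho 19 = A + A + A + r * W + u * K /\
  rd rho 22 = A + 3 + k + (((L - r) * n + v) * n + u) /\
  rd rho 23 = A + A + u /\ rd rho 24 = u /\
  rd rho 20 = fst (best G X (slack G X r) (S (L - r)) v R u) /\
  rd rho 21 = snd (best G X (slack G X r) (S (L - r)) v R u).

Lemma inner_step_ht r v R h u rho :
  length rho = 28 -> r <= L -> v < n -> R < K -> u < n -> dp_heap (idx (S r) v R) h ->
  inner_inv r v R (idx (S r) v R) h u rho h ->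
  ht B inner_step rho h 18 (fun rho' h' =>
    inner_inv r v R (idx (S r) v R) h (S u) rho' h' /\
    (rd rho' 24 <? rd rho' 3) = (S u <? n)).
Proof.
  intros Hl Hr Hv HR Hu ((Hbit & Hedge) & Hsl & _)
    (_ & ((B0 & B1 & B3 & B5 & B6 & B7 & B8) & R4 & R10 & R11 & R12 & R13 & R14) &
     R15 & R18 & R19 & R22 & R23 & R24 & R20 & R21).
  size_facts. set (i := idx (S r) v R) in *.
  assert (Hi : i < D) by (apply idx_lt_D; trivial; lia).
  open_regs rho Hl.
  pose proof (rm_le R (bit X u)) as Hrm.
  pose proof (bit_le_q u) as Hbq.
  pose proof (slack_le G X r u (rm R (bit X u))) as Hsle.
  pose proof (edge_bit_le G (S (L - r)) v u) as Hel.
  pose proof (idx_lt_row r u (rm R (bit X u)) (S r) v R Hu ltac:(lia) ltac:(lia)) as Hid.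
  (* Unification collects the cost from the commands that follow; the shelved inequality compares it
     with the claimed one at the end. *)
  eapply ht_post; [|shelve|intros ? ? _ H; exact H].
  eapply ht_seq_cps, ht_blk; [reflexivity|].
  wp_step. loaded (bit X u); [now apply Hbit|].
  do 5 wp_step. change (R - (R / bit X u) mod 2 * bit X u) with (rm R (bit X u)).
  wp_step. wp_step.
  loaded (slack G X r u (rm R (bit X u))).
  { rewrite <- Hsl by (trivial; lia). f_equal. unfold idx. rewrite HW. ring. }
  wp_step.
  loaded (edge_bit G (S (L - r)) v u).
  { apply Hedge; trivial; lia. }
  do 3 wp_step.
  set (cand := slack G X r u (rm R (bit X u)) * edge_bit G (S (L - r)) v u) in *.
  assert (Hcand : cand <= q) by (unfold cand; clear - Hsle Hel Hr HLq; nia).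
  assert (Eb : best G X (slack G X r) (S (L - r)) v R (S u) =
               (let p := best G X (slack G X r) (S (L - r)) v R u in
                if fst p <? cand then (cand, u) else p)) by reflexivity.
  cbv zeta in Eb.
  set (p := best G X (slack G X r) (S (L - r)) v R u) in *.
  eapply ht_seq_cps, ht_ifnz; [cbn; lia| |]; cbn [nth]; intro Hd.
  - eapply ht_seq_cps, ht_blk; [reflexivity|]. do 5 wp_step.
    apply ht_blk; [reflexivity|]. wp_step. split; [|ltb_eq].
    assert (Ep : best G X (slack G X r) (S (L - r)) v R (S u) = p).
    { rewrite Eb. destruct (Nat.ltb_spec (fst p) cand); [lia|reflexivity]. }
    unfold inner_inv. rewrite Ep. cbn [nth].
    repeat (split; [solve [trivial|lia|repeat split]|]). reflexivity.
  - eapply ht_blk; [reflexivity|]. do 3 wp_step.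
    eapply ht_seq_cps, ht_blk; [reflexivity|]. do 5 wp_step.
    apply ht_blk; [reflexivity|]. wp_step. split; [|ltb_eq].
    assert (Ep : best G X (slack G X r) (S (L - r)) v R (S u) = (cand, u)).
    { rewrite Eb. destruct (Nat.ltb_spec (fst p) cand); [reflexivity|lia]. }
    unfold inner_inv. rewrite Ep. cbn [nth fst snd].
    repeat (split; [solve [trivial|lia|repeat split]|]). lia.
  Unshelve. cbn. lia.
Qed.

Lemma inputs_frame h h' :
  (forall x, x < A + A + A -> h' x = h x) -> inputs h -> inputs h'.
Proof.
  intros F (H1 & H2). size_facts. split.
  - intros x Hx. rewrite F by lia. auto.
  - intros t v u Ht Hv Hu. rewrite F; [auto|].
    assert ((t * n + v) * n + u < L * (n * n) + n * n) by (clear - Ht Hv Hu; nia). lia.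
Qed.

Lemma fill_entry_ht i rho h :
  length rho = 28 -> W <= i < D -> dp_regs rho -> rd rho 15 = i -> dp_heap i h ->
  ht B fill_entry rho h (26 + n * 19) (fun rho' h' =>
    dp_regs rho' /\ rd rho' 15 = S i /\ dp_heap (S i) h').
Proof.
  intros Hl (HWi & HiD)
    ((B0 & B1 & B3 & B5 & B6 & B7 & B8) & R4 & R10 & R11 & R12 & R13 & R14) R15 Hh.
  destruct (idx_surj i HiD HWi) as (r & v & R & Hr & Hv & HR & Ei).
  destruct (idx_decode (S r) v R Hv HR) as (E1 & E2 & E3). rewrite <- Ei in E1, E2, E3.
  size_facts.
  pose proof (slack_le G X r v R) as Hsle.
  assert (Hiq : i <= q ^ 5) by lia.
  assert (Eip : A + A + A + i - W = A + A + A + idx r v R).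
  { assert (i = idx r v R + W) by (rewrite Ei, HW; unfold idx; ring). lia. }
  assert (Hid : idx r v R < i) by (rewrite Ei; apply idx_lt_row; trivial; lia).
  open_regs rho Hl.
  eapply ht_post; [|shelve|intros ? ? _ H; exact H].
  eapply ht_seq_cps, ht_blk; [reflexivity|].
  wp_step. rewrite E1. wp_step. wp_step. rewrite E2. wp_step. rewrite E3.
  wp_step. wp_step. rewrite Eip.
  wp_step. loaded (slack G X r v R); [now apply Hh|].
  do 4 wp_step. replace (S r - 1) with r by lia.
  do 4 wp_step. replace (L + 1 - S r) with (L - r) by lia.
  do 7 wp_step.
  eapply ht_seq.
  { apply (ht_loop B _ 24 3 _ _ n 18 (inner_inv r v R i h)).
    - cbn; lia.
    - cbn; lia.
    - lia.
    - split; [trivial|]. cbn [best fst snd nth]. unfold dp_regs, base. cbn [nth].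
      repeat (split; [solve [trivial|lia|repeat split; lia]|]). lia.
    - intros u rho' h' Hu Hl' Hi'. pose proof Hi' as (Eh & _). subst h'.
      rewrite Ei in *. apply inner_step_ht; trivial. }
  intros rho h' Hl (Eh &
    ((B0 & B1 & B3 & B5 & B6 & B7 & B8) & R4 & R10 & R11 & R12 & R13 & R14) &
    R15 & R18 & R19 & R22 & R23 & R24 & R20 & R21).
  subst h'. cbn [length] in Hl.
  change (rd rho 20 = slack G X (S r) v R) in R20.
  change (rd rho 21 = choice G X r v R) in R21.
  open_regs rho Hl.
  eapply ht_seq_cps, ht_blk; [reflexivity|].
  do 6 wp_step. apply ht_blk; [reflexivity|]. wp_step.
  split; [repeat split; trivial|]. split; [lia|].
  destruct Hh as (Hin & Hsl & Hch).
  assert (F : forall x, x <> A + A + A + i -> x <> A + A + A + i + D -> w0 x = h x).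
  { intros x N1 N2. rewrite Hw0, upd_neq, Hw, upd_neq; trivial. }
  assert (Esl : w0 (A + A + A + i) = slack G X (S r) v R).
  { rewrite Hw0, upd_neq, Hw, upd_eq by lia. reflexivity. }
  assert (Ech : w0 (A + A + A + i + D) = choice G X r v R).
  { rewrite Hw0, upd_eq. reflexivity. }
  split; [|split].
  - revert Hin. apply inputs_frame. intros x Hx. apply F; lia.
  - intros r' v' R' Hv' HR' Hlt.
    destruct (Nat.eq_dec (idx r' v' R') i) as [E|N].
    + destruct (idx_decode r' v' R' Hv' HR') as (F1 & F2 & F3).
      rewrite E in F1, F2, F3. rewrite E. rewrite Esl. congruence.
    + rewrite F by lia. apply Hsl; trivial; lia.
  - intros r' v' R' Hv' HR' Hlt.
    destruct (Nat.eq_dec (idx (S r') v' R') i) as [E|N].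
    + destruct (idx_decode (S r') v' R' Hv' HR') as (F1 & F2 & F3).
      rewrite E in F1, F2, F3. rewrite E.
      replace (A + A + A + D + i) with (A + A + A + i + D) by lia. rewrite Ech. congruence.
    + rewrite F by lia. apply Hch; trivial; lia.
  Unshelve. cbn. lia.
Qed.

Lemma fill_tables_ht rho h :
  length rho = 28 -> base rho -> rd rho 4 = A + 3 + k -> rd rho 10 = K -> rd rho 11 = A + A ->
  inputs h -> (forall x, A + A + A <= x -> h x = 0) ->
  ht B fill_tables rho h (6 + (D - W) * (27 + n * 19)) (fun rho' h' =>
    dp_regs rho' /\ dp_heap D h').
Proof.
  intros Hl (B0 & B1 & B3 & B5 & B6 & B7 & B8) R4 R10 R11 Hin Hz.
  size_facts. open_regs rho Hl.
  assert (HWD2 : W < D) by (rewrite HD; clear - Hn1 HnW; nia).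
  apply (ht_seq_cps B _ _ _ _ 6).
  apply (ht_blk B [IMul 12 3 10; IAdd 13 8 0; IAdd 13 13 0; IMul 13 13 12;
                  IAdd 14 11 1; IAdd 15 12 7]);
    [reflexivity|].
  wp_step. rewrite <- HW. wp_step. wp_step. wp_step.
  replace ((L + 1 + 1) * W) with D by (rewrite HD; ring).
  do 3 wp_step.
  eapply ht_post.
  - apply (ht_loop B _ 15 13 _ _ (D - W) (26 + n * 19) (fun i rho h' =>
      dp_regs rho /\ rd rho 15 = W + i /\ dp_heap (W + i) h')).
    + cbn; lia.
    + cbn; lia.
    + lia.
    + split; [repeat split|]. split; [cbn; lia|]. rewrite Nat.add_0_r.
      split; [trivial|]. split; intros r v R Hv HR Hlt.
      (* Layer 0 is never written: [slack 0] vanishes, and so does fresh memory. *)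
      * destruct r as [|r]; [apply Hz; lia|].
        assert (W <= idx (S r) v R) by (rewrite HW; unfold idx; clear; nia). lia.
      * assert (W <= idx (S r) v R) by (rewrite HW; unfold idx; clear; nia). lia.
    + intros i rho h' Hi Hl (Hr & H15 & Hh). cbn [length] in Hl.
      eapply ht_post; [apply (fill_entry_ht (W + i)); trivial; lia|lia|].
      intros rho' h2 Hl2 (Hr' & H15' & Hh').
      rewrite Nat.add_succ_r. split; [auto|].
      destruct Hr' as (_ & _ & _ & _ & _ & H13 & _). rewrite H15', H13. ltb_eq.
  - lia.
  - intros rho' h' _ (H1 & _ & H2). replace (W + (D - W)) with D in H2 by lia. auto.
Qed.

(** * Reading off the tour *)

Definition R0 : nat := rm (K - 1) (bit X s).

Definition out_heap (l : list (nat * nat)) (h : nat -> nat) : Prop :=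
  forall i, i < length l ->
    (h (A + A + A + D + D + (2 + 2 * i)), h (A + A + A + D + D + (3 + 2 * i))) = nth i l (0, 0).

Definition extraction_inv (j : nat) (rho : list nat) (h : nat -> nat) : Prop :=
  dp_regs rho /\ rd rho 16 = S L - j /\ rd rho 19 = A + A + A + D + D /\
  rd rho 20 = slack G X (S L) s R0 /\ dp_heap D h /\
  exists v R l,
    v < n /\ R < K /\ rd rho 17 = v /\ rd rho 18 = R /\
    rd rho 22 = A + A + A + D + D + (2 + 2 * length l) /\ length l <= j /\
    l ++ extract G X (S L - j) v R = extract G X (S L) s R0 /\ out_heap l h.

Lemma dp_heap_frame h h' :
  (forall x, x < A + A + A + D + D -> h' x = h x) -> dp_heap D h -> dp_heap D h'.
Proof.
  intros F (H1 & H2 & H3). size_facts. split; [|split].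
  - revert H1. apply inputs_frame. intros x Hx. apply F. lia.
  - intros r v R Hv HR Hlt. rewrite F by lia. auto.
  - intros r v R Hv HR Hlt. rewrite F by lia. auto.
Qed.

Lemma start_extraction_ht rho h :
  length rho = 28 -> dp_regs rho -> dp_heap D h ->
  ht B start_extraction rho h 20 (extraction_inv 0).
Proof.
  intros Hl ((B0 & B1 & B3 & B5 & B6 & B7 & B8) & R4 & R10 & R11 & R12 & R13 & R14) Hh.
  size_facts. pose proof (bit_le_q s) as Hbq.
  pose proof (rm_le (K - 1) (bit X s)) as Hrm. fold R0 in Hrm.
  open_regs rho Hl. apply ht_blk; [reflexivity|].
  do 3 wp_step. loaded (bit X s); [now apply Hh|].
  do 6 wp_step.
  change (K - 1 - ((K - 1) / bit X s) mod 2 * bit X s) with R0.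
  do 9 wp_step.
  loaded (slack G X (S L) s R0).
  { replace (((L + 1) * n + (s + 0)) * K + R0 + (A + A + A)) with (A + A + A + idx (S L) s R0)
      by (unfold idx; ring).
    apply Hh; [lia|lia|]. apply idx_lt_D; lia. }
  do 3 wp_step.
  split; [repeat split|]. cbn [nth]. repeat (split; [solve [trivial|lia]|]).
  exists s, R0, []. cbn [length app].
  repeat (split; [solve [trivial|lia]|]).
  intros i Hi. cbn in Hi. lia.
Qed.

Lemma extraction_step_ht j rho h :
  length rho = 28 -> j <= L -> extraction_inv j rho h ->
  ht B extraction_step rho h 27 (fun rho' h' =>
    extraction_inv (S j) rho' h' /\ (rd rho' 7 <? rd rho' 16) = (S j <? S L)).
Proof.
  intros Hl Hj
    (((B0 & B1 & B3 & B5 & B6 & B7 & B8) & R4 & R10 & R11 & R12 & R13 & R14) &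
     R16 & R19 & R20 & Hh & v & R & l & Hv & HR & R17 & R18 & R22 & Hll & Hex & Hout).
  size_facts.
  replace (S L - j) with (S (L - j)) in * by lia. set (r := L - j) in *.
  assert (Hr : r <= L) by lia.
  pose proof (choice_lt G X r v R Hv) as Hu. set (u := choice G X r v R) in *.
  pose proof (bit_le_q u) as Hbq.
  pose proof (idx_lt_D (S r) v R ltac:(lia) Hv HR) as Hid.
  open_regs rho Hl.
  assert (Hxl : length l <= q) by lia.
  eapply ht_post; [|shelve|intros ? ? _ H; exact H].
  eapply ht_seq_cps, ht_blk; [reflexivity|].
  do 7 wp_step.
  loaded u.
  { replace ((S r * n + v) * K + R + (A + A + A) + D) with (A + A + A + D + idx (S r) v R)
      by (unfold idx; ring).
    now apply Hh. }
  do 4 wp_step.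
  cbn [extract] in Hex. fold u in Hex.
  eapply ht_seq_cps, ht_ifnz; [cbn; lia| |]; cbn [nth]; intro Hd.
  - eapply ht_seq_cps, ht_blk; [reflexivity|]. do 2 wp_step.
    apply ht_blk; [reflexivity|]. wp_step. split; [|ltb_eq].
    assert (u = v) by lia. destruct (Nat.eqb_spec u v); [|lia].
    split; [repeat split|]. cbn [nth]. repeat (split; [solve [trivial|lia]|]).
    exists v, R, l. replace (S L - S j) with r by lia.
    repeat (split; [solve [trivial|lia]|]). trivial.
  - eapply ht_blk; [reflexivity|].
    destruct (Nat.eqb_spec u v); [lia|].
    wp_step. wp_step. wp_step. replace (L + 1 + 1 - S r) with (S (L - r)) by lia.
    do 7 wp_step. loaded (bit X u).
    { rewrite Hw0, upd_neq, Hw, upd_neq by lia. now apply Hh. }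
    do 6 wp_step. change (R - (R / bit X u) mod 2 * bit X u) with (rm R (bit X u)).
    pose proof (rm_le R (bit X u)) as Hrm.
    eapply ht_seq_cps, ht_blk; [reflexivity|]. do 2 wp_step.
    apply ht_blk; [reflexivity|]. wp_step. split; [|ltb_eq].
    split; [repeat split|]. cbn [nth].
    assert (F : forall x, x < A + A + A + D + D + (2 + 2 * length l) -> w0 x = h x).
    { intros x Hx. rewrite Hw0, upd_neq, Hw, upd_neq by lia. reflexivity. }
    split; [lia|]. split; [lia|]. split; [trivial|].
    split; [revert Hh; apply dp_heap_frame; intros x Hx; apply F; lia|].
    exists u, (rm R (bit X u)), (l ++ [(S (L - r), u)]).
    replace (S L - S j) with r by lia. rewrite length_app. cbn [length].
    repeat (split; [solve [trivial|lia]|]).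
    split; [rewrite <- app_assoc; exact Hex|].
    intros i Hi. rewrite length_app in Hi. cbn [length] in Hi.
    destruct (Nat.eq_dec i (length l)) as [->|Ni].
    + rewrite app_nth2, Nat.sub_diag by lia. cbn [nth].
      rewrite Hw0, upd_neq, Hw, upd_eq by lia. f_equal.
      replace (A + A + A + D + D + (3 + 2 * length l))
        with (A + A + A + D + D + (2 + 2 * length l) + 1) by lia.
      now rewrite upd_eq.
    + rewrite app_nth1, <- Hout by lia. f_equal; apply F; lia.
  Unshelve. cbn. lia.
Qed.

Lemma extraction_ht rho h :
  length rho = 28 -> dp_regs rho -> dp_heap D h ->
  let l := extract G X (S L) s R0 in
  ht B extraction rho h (27 + S L * 28) (fun rho' h' =>
    rd rho' 0 = 0 /\ rd rho' 8 = L /\ rd rho' 19 = A + A + A + D + D /\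
    rd rho' 20 = slack G X (S L) s R0 /\
    h' (A + A + A + D + D + 1) = length l /\ out_heap l h').
Proof.
  intros Hl Hr Hh l. size_facts.
  eapply ht_post; [|shelve|intros ? ? _ H; exact H].
  eapply ht_seq; [apply start_extraction_ht; trivial|].
  clear dependent h. intros rho1 h Hl1 HI. rewrite Hl in Hl1.
  eapply ht_seq.
  { apply (ht_loop B _ 7 16 _ _ (S L) 27 extraction_inv); [lia|lia|lia|trivial|].
    intros i rho' h' Hi Hl' HI'. apply extraction_step_ht; trivial; lia. }
  clear dependent h. clear dependent rho.
  intros rho h Hl (((B0 & B1 & B3 & B5 & B6 & B7 & B8) & _) &
     R16 & R19 & R20 & Hh & v & R & l' & Hv & HR & R17 & R18 & R22 & Hll & Hex & Hout).
  rewrite Hl1 in Hl. clear dependent rho1.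
  rewrite Nat.sub_diag in Hex. change (extract G X 0 v R) with (@nil (nat * nat)) in Hex.
  rewrite app_nil_r in Hex.
  fold l in Hex. rewrite Hex in *. clear l' Hex.
  open_regs rho Hl.
  eapply ht_seq_cps, ht_blk; [reflexivity|].
  do 4 wp_step.
  (* The buffer reserves two cells for the answer and the length, hence the final [- 1] after
     halving. *)
  replace ((A + A + A + D + D + (2 + 2 * length l) - (A + A + A + D + D)) / 2 - 1)
    with (length l).
  2:{ replace (A + A + A + D + D + (2 + 2 * length l) - (A + A + A + D + D))
        with ((1 + length l) * 2) by lia. rewrite Nat.div_mul; lia. }
  do 4 wp_step. apply ht_blk; [reflexivity|]. wp_step.
  repeat (split; [solve [trivial]|]). rewrite Hw. split; [apply upd_eq|].
  intros i Hi. rewrite !upd_neq by lia. now apply Hout.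
  Unshelve. cbn. lia.
Qed.

(** * Delivering the output, and the whole run *)

Lemma load_code_wp m a rho h (Q : _ -> _ -> Prop) :
  length rho = 28 -> m < 28 -> 28 <= a -> rd rho 0 = a + S m -> (m = 0 \/ rd rho 1 = 1) ->
  (forall rho', length rho' = 28 -> (forall x, 1 <= x <= m -> rd rho' x = h (a + x)) ->
     (forall x, m < x -> rd rho' x = rd rho x) -> Q rho' h) ->
  wp B (load_code m) rho h Q.
Proof.
  revert rho. induction m as [|m IH]; intros rho Hl Hm Ha H0 H1 HQ; cbn [load_code wp wp1].
  - apply HQ; trivial. lia.
  - destruct H1 as [|H1]; [lia|].
    rewrite !length_wr, !nth_wr, H0, H1 by lia. cbn [Nat.eqb].
    split; [lia|]. intros w Hw.
    apply IH; rewrite ?length_wr; trivial; try lia.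
    + rewrite !nth_wr by (rewrite ?length_wr; lia). cbn [Nat.eqb]. lia.
    + destruct m as [|m]; [now left|right].
      rewrite !nth_wr by (rewrite ?length_wr; lia). exact H1.
    + intros rho' Hl' F1 F2. apply HQ; trivial.
      * intros x Hx. destruct (Nat.eq_dec x (S m)) as [->|]; [|apply F1; lia].
        rewrite F2, nth_wr, Nat.eqb_refl by (rewrite ?length_wr; lia).
        rewrite Hw. f_equal. lia.
      * intros x Hx. rewrite F2, !nth_wr by (rewrite ?length_wr; lia).
        destruct (Nat.eqb_spec x (S m)), (Nat.eqb_spec x 0); trivial; lia.
Qed.

Lemma write_output_ht rho h :
  length rho = 28 -> rd rho 8 = L -> rd rho 19 = A + A + A + D + D ->
  ht B write_output rho h (63 + (2 * L + 3) * 5) (fun rho' h' =>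
    rd rho' 0 = 1 /\
    forall x, 1 <= x < 31 + 2 * L -> view rho' h' x = h (A + A + A + D + D + x)).
Proof.
  intros Hl R8 R19. size_facts. open_regs rho Hl.
  eapply ht_post; [|shelve|intros ? ? _ H; exact H].
  eapply ht_seq_cps, ht_blk; [reflexivity|]. do 6 wp_step.
  eapply ht_seq.
  { apply (ht_loop B _ 9 10 _ _ (2 * L + 3) 4 (fun i rho h' =>
      rd rho 0 = 1 /\ rd rho 9 = 28 + i /\ rd rho 10 = L + L + 31 /\
      rd rho 19 = A + A + A + D + D /\
      (forall x, 28 <= x < 28 + i -> h' x = h (A + A + A + D + D + x)) /\
      (forall x, 28 + i <= x -> h' x = h x))).
    - cbn; lia.
    - cbn; lia.
    - lia.
    - cbn [nth]. repeat (split; [solve [trivial|lia]|]). auto.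
    - intros i rho h' Hi Hl (Z0 & Z9 & Z10 & Z19 & F1 & F2). cbn [length] in Hl.
      open_regs rho Hl. assert (i <= q ^ 8) by lia.
      apply ht_blk; [reflexivity|]. do 5 wp_step. split; [|ltb_eq].
      repeat (split; [solve [trivial|lia]|]). rewrite Hw0. split.
      + intros x Hx. destruct (Nat.eq_dec x (28 + i)) as [->|Nx].
        * rewrite upd_eq, Hw. apply F2. lia.
        * rewrite upd_neq by lia. apply F1. lia.
      + intros x Hx. rewrite upd_neq by lia. apply F2. lia. }
  intros rho h' Hl (Z0 & Z9 & Z10 & Z19 & F1 & F2). cbn [length] in Hl.
  open_regs rho Hl.
  eapply ht_seq_cps, ht_blk; [reflexivity|]. do 4 wp_step.
  eapply ht_seq_cps, ht_blk; [reflexivity|].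
  apply (load_code_wp _ (A + A + A + D + D)); cbn [nth]; try lia; [reflexivity|].
  intros rho' Hl' F3 _.
  eapply ht_seq_cps, ht_blk; [rewrite Hl'; reflexivity|].
  open_regs rho' Hl'.
  do 2 wp_step. apply ht_blk; [reflexivity|]. wp_step. split; [trivial|].
  intros x Hx. unfold view. cbn [length].
  destruct (Nat.ltb_spec x 28).
  - transitivity (h' (A + A + A + D + D + x)); [|apply F2; lia].
    rewrite <- F3 by lia. destruct x as [|x]; [lia|]. reflexivity.
  - apply F1. lia.
  Unshelve. cbn. lia.
Qed.

Lemma main_ht :
  ht B main (map enc (seq 0 28)) enc
    (11 + (52 + (14 + ((A - 28) * 6 + (5 + k * 7 + (6 + (D - W) * (27 + n * 19) +
      (27 + S L * 28 + (S (63 + (2 * L + 3) * 5) + 0))))))))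
    (fun rho h =>
      (slack G X (S L) s R0 = 0 -> rd rho 0 = 0) /\
      (slack G X (S L) s R0 <> 0 ->
       rd rho 0 = 1 /\ decode_steps (view rho h) = extract G X (S L) s R0)).
Proof.
  eapply ht_seq; [apply free_registers_ht|].
  intros rho h Hl (H0 & H1 & H2 & H3). rewrite length_map, length_seq in Hl.
  eapply ht_seq; [now apply save_ht|].
  clear dependent h. intros rho1 h Hl1 (G0 & G1 & G2 & G3). rewrite Hl in Hl1.
  clear dependent rho.
  eapply ht_seq; [now apply read_sizes_ht|].
  intros rho h' Hl (Hb & H9 & ->). rewrite Hl1 in Hl. clear dependent rho1.
  eapply ht_seq; [now apply copy_input_ht|].
  clear dependent h. intros rho1 h Hl1 (Hb1 & Hc). rewrite Hl in Hl1. clear dependent rho.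
  eapply ht_seq; [now apply fill_bits_ht|].
  intros rho h' Hl ((Hb & R4 & R10 & R11) & Hin & Hz). rewrite Hl1 in Hl. clear dependent rho1.
  clear dependent h. rename h' into h.
  eapply ht_seq; [now apply fill_tables_ht|].
  clear dependent h. intros rho1 h Hl1 (Hr & Hh). rewrite Hl in Hl1. clear dependent rho.
  eapply ht_seq; [now apply extraction_ht|].
  clear dependent h. intros rho h Hl (Z0 & R8 & R19 & R20 & Hlen & Hout). rewrite Hl1 in Hl.
  clear dependent rho1.
  pose proof (length_extract G X (S L) s R0) as Hle.
  apply ht_seq_cps. apply ht_ifnz; [lia| |]; intro Hd; rewrite R20 in Hd.
  - apply ht_blk; [reflexivity|]. cbn [wp]. now split.
  - eapply ht_post; [now apply write_output_ht|lia|].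
    intros rho1 h1 Hl1 (Z1 & F). apply ht_blk; [reflexivity|]. cbn [wp].
    split; [easy|]. intros _. split; [trivial|].
    set (l := extract G X (S L) s R0) in *.
    unfold decode_steps. rewrite F, Hlen by lia.
    apply nth_ext with (d := (0, 0)) (d' := (0, 0)).
    + now rewrite length_map, length_seq.
    + intros i Hi. rewrite length_map, length_seq in Hi.
      set (f := fun i => _).
      rewrite (nth_indep _ (0, 0) (f 0)) by now rewrite length_map, length_seq.
      rewrite map_nth, seq_nth, <- Hout by trivial.
      unfold f. rewrite !F by lia. reflexivity.
Qed.

End Run.

(** * Correctness, running time and word size *)

Lemma view_low (m : nat -> nat) N : view (map m (seq 0 N)) m = m.
Proof.
  apply functional_extensionality. intro x. unfold view. rewrite length_map, length_seq.
  destruct (Nat.ltb_spec x N); [|reflexivity].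
  rewrite (nth_indep _ 0 (m 0)) by now rewrite length_map, length_seq.
  now rewrite map_nth, seq_nth.
Qed.

Lemma code_at_mid l1 l2 l3 : code_at (l1 ++ l2 ++ l3) (length l1) l2.
Proof.
  intros i x E. rewrite nth_error_app2, Nat.add_comm, Nat.add_sub by lia.
  rewrite nth_error_app1; trivial. apply nth_error_Some. congruence.
Qed.

Definition texp_program : program :=
  [IJmpZ 1 (3 + csize main); IJmpZ 3 (5 + csize main)] ++ comp 2 main ++
  [IHalt; IConst 0 0; IHalt; IConst 0 1; IConst 1 0; IHalt].

(** The table has [(L + 1) n K <= 2 L n K] computed entries of at most [27 + 19 n <= 46 n] steps
    each; moving the input is linear in [A]. *)
Lemma run_time_bound n L k K :
  1 <= n -> 1 <= L -> 1 <= k -> 1 <= K ->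
  64 * (L * (n * n) + k) * 6 + k * 7 + ((L + 2) * (n * K) - n * K) * (27 + n * 19) + L * 38 <=
  1000 * (K * k * L * (n * n)).
Proof.
  intros Hn HL Hk HK.
  assert (H1 : 1 <= n * n) by nia.
  assert (H2 : L * (n * n) <= K * L * (n * n)) by nia.
  assert (H3 : L <= L * (n * n)) by nia.
  assert (H4 : n <= n * n) by nia.
  assert (H4' : n * n <= L * (n * n)) by nia.
  assert (H5 : K * L * (n * n) <= K * k * L * (n * n)).
  { apply Nat.mul_le_mono_r, Nat.mul_le_mono_r. nia. }
  assert (H5' : k <= K * k * L * (n * n)).
  { replace (K * k * L * (n * n)) with (k * (K * L * (n * n))) by ring. nia. }
  assert (H6 : ((L + 2) * (n * K) - n * K) * (27 + n * 19) <= 92 * (K * L * (n * n))).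
  { replace ((L + 2) * (n * K) - n * K) with ((L + 1) * (n * K)) by lia.
    transitivity ((2 * L) * (n * K) * (46 * n)).
    - apply Nat.mul_le_mono; [apply Nat.mul_le_mono_r; lia|lia].
    - apply Nat.eq_le_incl. ring. }
  lia.
Qed.

Theorem theorem2 :
  exists (P : program) (C c : nat),
    forall I : instance, instance_wf I ->
      let n := tg_n (i_G I) in
      let L := tg_L (i_G I) in
      let k := i_k I in
      exists T : nat,
        T <= C * (2 ^ k * k * L * (n * n) + 1) /\
        halted P (exec P T (init_state I)) /\
        (forall j, j < T ->
           written_value P (exec P j (init_state I))
             <= (2 ^ k * (L + 2) * ((n + 2) * (n + 2))) ^ c) /\
        correct_output I (mem (exec P T (init_state I))).
Proof.
  exists texp_program, 1000, 80. intros I wf n L k.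
  set (q := 2 ^ k * (L + 2) * ((n + 2) * (n + 2))).
  assert (Hq : 1 <= q ^ 80).
  { apply Nat.neq_0_lt_0, Nat.pow_nonzero. unfold q. pose proof (Nat.pow_nonzero 2 k). nia. }
  pose proof (s_lt I wf) as Hs. fold n in Hs.
  unfold init_state.
  assert (Fin : forall T p m, reach (q ^ 80) texp_program 0 (encode I) T p m ->
    nth_error texp_program p = Some IHalt -> T <= 1000 * (2 ^ k * k * L * (n * n) + 1) ->
    correct_output I m ->
    exists T, T <= 1000 * (2 ^ k * k * L * (n * n) + 1) /\
      halted texp_program (exec texp_program T (MState 0 (encode I))) /\
      (forall j, j < T ->
         written_value texp_program (exec texp_program j (MState 0 (encode I))) <= q ^ 80) /\
      correct_output I (mem (exec texp_program T (MState 0 (encode I))))).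
  { intros T p m (E & Wr) Hp HT Hc. exists T. rewrite E. unfold halted. cbn [pc mem].
    rewrite Hp. auto. }
  assert (E0 : nth_error texp_program 0 = Some (IJmpZ 1 (3 + csize main))) by reflexivity.
  assert (E1 : nth_error texp_program 1 = Some (IJmpZ 3 (5 + csize main))) by reflexivity.
  assert (S0 : reach (q ^ 80) texp_program 0 (encode I) 1
                 (if L =? 0 then 3 + csize main else 1) (encode I)).
  { apply reach_step; unfold step, written_value; cbn [pc mem]; rewrite E0; [reflexivity|lia]. }
  assert (S1 : reach (q ^ 80) texp_program 1 (encode I) 1
                 (if k =? 0 then 5 + csize main else 2) (encode I)).
  { apply reach_step; unfold step, written_value; cbn [pc mem]; rewrite E1; [reflexivity|lia]. }
  assert (Const : forall p a c m, nth_error texp_program p = Some (IConst a c) -> c <= 1 ->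
    reach (q ^ 80) texp_program p m 1 (S p) (upd m a c)).
  { intros p a c m E Hc. apply reach_step; unfold step, written_value; cbn [pc mem]; rewrite E;
      [reflexivity|lia]. }
  destruct (Nat.eqb_spec L 0) as [HL|HL].
  { eapply Fin; [eapply reach_trans; [exact S0|eapply Const]| | |].
    - reflexivity.
    - lia.
    - reflexivity.
    - lia.
    - split; [|reflexivity]. intros (steps & (Hw & _) & _). fold L in Hw. lia. }
  destruct (Nat.eqb_spec k 0) as [Hk|Hk].
  { eapply Fin;
      [eapply reach_trans; [exact S0|eapply reach_trans; [exact S1|
       eapply reach_trans; [eapply (Const _ 0 1)|eapply (Const _ 1 0)]]]| | |].
    1-5: solve [reflexivity|lia].
    - lia.
    - apply length_zero_iff_nil in Hk.
      assert (Opt : optimal_solution I []).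
      { split.
        - split; [split; [fold L; lia|split; [exact Hs|exact Logic.I]]|].
          rewrite Hk. intros x [].
        - intros steps _ a a'. unfold arrival. rewrite Hk.
          destruct steps as [|[? ?] ?]; cbn; congruence || (intros [= <-] [= <-]; lia). }
      split.
      + intros _. split; [reflexivity|exact Opt].
      + intro Hno. exfalso. apply Hno. exists []. apply Opt. }
  pose proof (main_ht I wf ltac:(fold L; lia) ltac:(fold k; lia)
    (64 * (L * (n * n) + k)) (2 ^ k) (n * 2 ^ k) ((L + 2) * (n * 2 ^ k)) q
    eq_refl eq_refl eq_refl eq_refl eq_refl) as H.
  destruct (H texp_program 2) as (T & rho & h & HT & R & _ & Hl & Hno & Hyes).
  - apply (code_at_mid [_; _]).
  - rewrite view_low. intro j. apply encode_bounded with (A := 64 * (L * (n * n) + k))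
      (K := 2 ^ k) (W := n * 2 ^ k) (D := (L + 2) * (n * 2 ^ k)); trivial; lia.
  - rewrite view_low in R. rewrite length_map, length_seq in Hl.
    eapply Fin; [eapply reach_trans; [exact S0|eapply reach_trans; [exact S1|exact R]]| | |].
    + reflexivity.
    + pose proof (run_time_bound n L k (2 ^ k) ltac:(lia) ltac:(lia) ltac:(lia)
        ltac:(pose proof (Nat.pow_nonzero 2 k); lia)).
      fold L n k in HT. lia.
    + destruct (extract_correct I wf ltac:(fold L; lia)) as (C1 & C2).
      change (rm (2 ^ i_k I - 1) (bit (i_X I) (i_s I))) with (R0 I (2 ^ k)) in C1, C2.
      unfold correct_output. rewrite view_reg by lia.
      split; intro Hy.
      * apply C1 in Hy. destruct (Hyes ltac:(lia)) as (Y1 & Y2).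
        split; [trivial|]. rewrite Y2. now apply C2.
      * apply Hno. destruct (Nat.eq_0_gt_0_cases
          (slack (i_G I) (i_X I) (S (tg_L (i_G I))) (i_s I) (R0 I (2 ^ k)))) as [|Hpos]; trivial.
        exfalso. apply Hy, C1. exact Hpos.
Qed.
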